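(* Let $\alpha$ be a non-zero algebraic number. Then there exist $N\in\mathbb{N}$ and $\alpha_1,\ldots,\alpha_N\in\mathrm{rad}(K_\alpha)$ such that $\alpha=\alpha_1\cdots\alpha_N$ and $M_\infty(\alpha)=\max\{M(\alpha_1),\ldots,M(\alpha_N)\}$. In particular, the infimum defining $M_\infty(\alpha)$ is attained.
   Context: Let $\overline{\mathbb{Q}}$ be an algebraic closure of $\mathbb{Q}$. For a number field $K$ and a place $v$ of $K$ lying over the place $p$ of $\mathbb{Q}$, let $\|\cdot\|_v$ be the absolute value on $K_v$ extending the usual $p$-adic (or real) absolute value on $\mathbb{Q}_p$, and set $|x|_v=\|x\|_v^{[K_v:\mathbb{Q}_p]/[K:\mathbb{Q}]}$. The Weil height of $x\in K$ is $H(x)=\prod_v\max\{1,|x|_v\}$ over all places $v$ of $K$; it is independent of $K$. The Mahler measure of $x\in\overline{\mathbb{Q}}$ is $M(x)=H(x)^{[\mathbb{Q}(x):\mathbb{Q}]}$. The ultrametric Mahler measure of a non-zero algebraic number $\alpha$ is $$M_\infty(\alpha)=\inf\Big\{\max_{1\le n\le N} M(\alpha_n): N\in\mathbb{N},\ \alpha_n\in\overline{\mathbb{Q}}^\times,\ \alpha=\prod_{n=1}^N\alpha_n\Big\}.$$ $K_\alpha$ denotes the Galois closure of $\mathbb{Q}(\alpha)$ over $\mathbb{Q}$. For a number field $K$, $\mathrm{rad}(K)=\{x\in\overline{\mathbb{Q}}^\times: x^r\in K \text{ for some } r\in\mathbb{N}\}$. *)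

(* Defs.v *)
From HB Require Import structures.
From mathcomp Require Import all_boot all_order all_algebra all_field.
From mathcomp Require Import all_classical all_reals all_analysis.

Set Implicit Arguments.
Unset Strict Implicit.
Unset Printing Implicit Defensive.

Import Order.TTheory GRing.Theory Num.Theory.
Import numFieldNormedType.Exports.

Local Open Scope classical_set_scope.
Local Open Scope ring_scope.

(* The algebraic closure of Q is algC, and a number field is a                *)
(* fieldExtType rat, that is, a finite extension of Q.                        *)

Definition absolute_value (R : realType) (F : fieldType) (v : F -> R) : Prop :=
  [/\ forall x, 0 <= v x,
      forall x, v x = 0 <-> x = 0,
      forall x y, v (x * y) = v x * v y &
      forall x y, v (x + y) <= v x + v y].

Variant rat_place : Type :=
  | RealPlace
  | PadicPlace (p : nat) of prime p.

Definition padic_abs (R : realType) (p : nat) (q : rat) : R :=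
  if q == 0 then 0
  else p%:R ^- logn p `|numq q|%N / p%:R ^- logn p `|denq q|%N.

Definition rat_place_abs (R : realType) (p : rat_place) (q : rat) : R :=
  match p with
  | RealPlace => ratr `|q|
  | PadicPlace p _ => padic_abs R p q
  end.

Definition lies_over (R : realType) (K : fieldExtType rat) (v : K -> R)
    (p : rat_place) : Prop :=
  forall q : rat, v q%:A = rat_place_abs R p q.

(* A place is represented by the unique absolute value ||.||_v in it that     *)
(* extends the usual real or p-adic absolute value of Q.                      *)
Definition places (R : realType) (K : fieldExtType rat) : set (K -> R) :=
  [set v | absolute_value v /\ exists p, lies_over v p].
Arguments places : clear implicits.

Definition cauchy_seq (R : realType) (F : fieldType) (v : F -> R)
    (u : nat -> F) : Prop :=
  forall e : R, 0 < e -> exists N : nat, forall m n : nat,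
    (N <= m)%N -> (N <= n)%N -> v (u m - u n) < e.

Definition null_seq (R : realType) (F : fieldType) (v : F -> R)
    (u : nat -> F) : Prop :=
  v (u n) @[n --> \oo] --> (0 : R).

(* K_v is the ring of v-Cauchy sequences in K modulo the null sequences, and  *)
(* Q_p its subfield of classes of v-Cauchy sequences of rationals. The family *)
(* e represents a basis of K_v over Q_p: it spans and is free modulo the null *)
(* sequences.                                                                 *)
Definition completion_basis (R : realType) (K : fieldExtType rat) (v : K -> R)
    (n : nat) (e : 'I_n -> nat -> K) : Prop :=
  let Qp_seq (c : nat -> rat) := cauchy_seq v (fun k => (c k)%:A) in
  [/\ forall i, cauchy_seq v (e i),
      forall u : nat -> K, cauchy_seq v u ->
        exists2 c : 'I_n -> nat -> rat, forall i, Qp_seq (c i) &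
          null_seq v (fun k => u k - \sum_(i < n) c i k *: e i k) &
      forall c : 'I_n -> nat -> rat, (forall i, Qp_seq (c i)) ->
        null_seq v (fun k => \sum_(i < n) c i k *: e i k) ->
        forall i, null_seq v (fun k => (c i k)%:A)].

(* [K_v : Q_p] *)
Definition local_degree (R : realType) (K : fieldExtType rat) (v : K -> R) :
    nat :=
  xget 0%N [set n | exists e : 'I_n -> nat -> K, completion_basis v e].

(* [K : Q] *)
Definition global_degree (K : fieldExtType rat) : nat := \dim {:K}.

(* |x|_v *)
Definition place_abs (R : realType) (K : fieldExtType rat) (v : K -> R)
    (x : K) : R :=
  v x `^ ((local_degree v)%:R / (global_degree K)%:R).

(* All but finitely many factors are 1, so the finitely supported product is  *)
(* the product over all the places.                                           *)
Definition field_height (R : realType) (K : fieldExtType rat) (x : K) : R :=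
  \big[*%R/1%R]_(v \in places R K) Num.max 1 (place_abs v x).

(* num_field_exists [:: x] provides Q(x) as an abstract field, an embedding   *)
(* of it in algC, and a preimage of x that generates it.                      *)
Definition Qfield (x : algC) : fieldExtType rat :=
  projT1 (num_field_exists [:: x]).

Definition Qfield_inj (x : algC) : {rmorphism Qfield x -> algC} :=
  projT1 (projT2 (num_field_exists [:: x])).

Definition Qfield_gen (x : algC) : Qfield x :=
  (s2val (projT2 (projT2 (num_field_exists [:: x]))))`_0.

Lemma Qfield_inj_gen (x : algC) : Qfield_inj x (Qfield_gen x) = x.
Proof.
rewrite /Qfield_gen /Qfield_inj.
by case: (projT2 (projT2 (num_field_exists [:: x]))) => [[|y []]] //= [].
Qed.

Lemma Qfield_genE (x : algC) : <<1; Qfield_gen x>>%VS = fullv.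
Proof.
rewrite /Qfield_gen.
case: (projT2 (projT2 (num_field_exists [:: x]))) => [[|y []]] //= _.
by rewrite adjoin_seq1.
Qed.

Definition weil_height (R : realType) (x : algC) : R :=
  field_height R (Qfield_gen x).

Definition mahler (R : realType) (x : algC) : R :=
  weil_height R x ^+ global_degree (Qfield x).

(* Factorizations have at least one factor, hence the N.+1. *)
Definition max_mahler (R : realType) (N : nat) (a : 'I_N.+1 -> algC) : R :=
  \big[Num.max/mahler R (a ord0)]_(i < N.+1) mahler R (a i).

Definition mahler_infty_set (R : realType) (alpha : algC) : set R :=
  [set m | exists (N : nat) (a : 'I_N.+1 -> algC),
     [/\ forall i, a i != 0, alpha = \prod_(i < N.+1) a i
       & m = max_mahler R a]].
Arguments mahler_infty_set : clear implicits.

Definition mahler_infty (R : realType) (alpha : algC) : R :=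
  inf (mahler_infty_set R alpha).

(* The Galois closure of Q(alpha) over Q in algC, as the least Galois number  *)
(* field containing alpha; iota @` E is an arbitrary such field.              *)
Definition galois_closure (alpha : algC) : set algC :=
  [set x | forall (L : splittingFieldType rat) (iota : {rmorphism L -> algC})
             (E : {subfield L}),
     galois 1 E -> (iota @` [set` E]) alpha -> (iota @` [set` E]) x].

Definition radicals (K : set algC) : set algC :=
  [set x | x != 0 /\ exists2 r : nat, (0 < r)%N & K (x ^+ r)].

(* Main.v *)
(** Every place of Q extends to an absolute value [w] on algC. By weak
    approximation every place of a number field K = Q(x) is [w] composed with
    an embedding of K in algC, and its local degree is the number of embeddings
    that induce it; hence the Mahler measure M(x) is the product over the places
    of Q, and over the conjugates z of x, of max(1, w z). In this form the
    inequalities below hold place by place.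

    Let K be the Galois closure of Q(alpha) and H the Galois group, over K, of a
    large normal field. For a factor a of alpha, let b be the product of the
    H-orbit of a and d its length. Since H is normal, the conjugates of b are
    products over disjoint H-orbits of conjugates of a, so M(b) <= M(a); and a
    d-th root c of b has M(c) <= M(b). The product of the roots c differs from
    alpha by a root of unity, which has Mahler measure 1. As all the b lie in K,
    Northcott's theorem leaves finitely many values M(b) below a given bound, so
    a factorization close enough to the infimum yields one, with factors in
    rad(K), that attains it. *)

(* The factors of [alpha] have unbounded degree, so Northcott's theorem cannot be applied to them;
   elements of K have degree at most the order of one Galois group. This is also why b multiplies
   the distinct elements of the orbit: the relative norm of a is the power of b by the order of the
   stabilizer, and the measure of that power can exceed M(a). The |H|-th power of c is again this
   relative norm, and the relative norms multiply to the |H|-th power of [alpha]; the root of unity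
   comes from there.

   No completion is constructed. The local degree is read off the constant sequences 1, g, ...,
   g^(d-1), whose coordinate functions take values in [algC] that w approximates by rationals. For a
   prime p, w comes from a subring of [algC] maximal among those without 1/p (Chevalley); since
   every algebraic number has a power equal to a unit times a power of p, its valuation is rational
   and w can be written down as a real function. *)
Require Import Defs.
From HB Require Import structures.
From mathcomp Require Import all_boot all_order all_algebra all_field.
From mathcomp Require Import all_classical all_reals all_analysis.
From mathcomp Require Import fingroup.
From mathcomp Require Import ring lra.

Set Implicit Arguments.
Unset Strict Implicit.
Unset Printing Implicit Defensive.

Import Order.TTheory GRing.Theory Num.Theory.
Import numFieldNormedType.Exports.

Local Open Scope classical_set_scope.
Local Open Scope ring_scope.

(** * Absolute values and weak approximation *)

Section AbsoluteValue.
Variables (R : realType) (F : fieldType) (v : F -> R).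
Hypothesis av : absolute_value v.

Lemma absv_ge0 x : 0 <= v x. Proof. by case: av. Qed.

Lemma absvM : {morph v : x y / x * y}. Proof. by case: av. Qed.

Lemma absvD_le x y : v (x + y) <= v x + v y. Proof. by case: av. Qed.

Lemma absv0 : v 0 = 0. Proof. by case: av => _ /(_ 0)[_ ->]. Qed.

Lemma absv_eq0 x : (v x == 0) = (x == 0).
Proof. by case: av => _ v0 _ _; apply/eqP/eqP => /v0. Qed.

Lemma absv_gt0 x : (0 < v x) = (x != 0).
Proof. by rewrite lt_def absv_eq0 absv_ge0 andbT. Qed.

Lemma absv1 : v 1 = 1.
Proof.
have v1 : v 1 != 0 by rewrite absv_eq0 oner_neq0.
by apply: (mulfI v1); rewrite -absvM !mulr1.
Qed.

Lemma absvX x n : v (x ^+ n) = v x ^+ n.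
Proof. by elim: n => [|n IHn]; rewrite ?absv1 // !exprS absvM IHn. Qed.

Lemma absvV x : v x^-1 = (v x)^-1.
Proof.
have [->|x0] := eqVneq x 0; first by rewrite invr0 absv0 invr0.
apply: (mulfI (_ : v x != 0)); first by rewrite absv_eq0.
by rewrite -absvM !divff ?absv1 ?absv_eq0.
Qed.

Lemma absv_prod I (r : seq I) P (f : I -> F) :
  v (\prod_(i <- r | P i) f i) = \prod_(i <- r | P i) v (f i).
Proof. by apply: (big_morph v absvM absv1). Qed.

Lemma absvN x : v (- x) = v x.
Proof.
rewrite -mulN1r absvM; suff -> : v (-1) = 1 by rewrite mul1r.
apply/eqP; rewrite -sqrp_eq1 ?absv_ge0 //.
by rewrite -absvX sqrrN expr1n absv1.
Qed.

Lemma absv_distrC x y : v (x - y) = v (y - x).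
Proof. by rewrite -absvN opprB. Qed.

Lemma absvB_le x y : v (x - y) <= v x + v y.
Proof. by rewrite -(absvN y) absvD_le. Qed.

Lemma absv_leB x y : v x - v y <= v (x + y).
Proof. by rewrite lerBlDr -{1}(addrK y x) absvB_le. Qed.

Lemma absv_sum_le I (r : seq I) P (f : I -> F) :
  v (\sum_(i <- r | P i) f i) <= \sum_(i <- r | P i) v (f i).
Proof.
elim/big_rec2: _ => [|i y x _ le_xy]; first by rewrite absv0.
by rewrite (le_trans (absvD_le _ _)) // lerD2l.
Qed.

End AbsoluteValue.

Lemma absolute_value_comp (R : realType) (F E : fieldType) (v : F -> R)
    (f : {rmorphism E -> F}) :
  absolute_value v -> absolute_value (v \o f).
Proof.
move=> av; split=> [x|x|x y|x y] /=.
- exact: absv_ge0 av _.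
- split=> [/eqP|->]; last by rewrite rmorph0 (absv0 av).
  by rewrite (absv_eq0 av) fmorph_eq0 => /eqP.
- by rewrite rmorphM (absvM av).
- by rewrite rmorphD (absvD_le av).
Qed.

Lemma near_exprM_lt (R : realType) (a c e : R) :
  0 <= a < 1 -> 0 < e -> \forall k \near \oo, a ^+ k * c < e.
Proof.
move=> /andP[a0 a1] e0; have a1' : `|a| < 1 by rewrite ger0_norm.
have /cvgr0_norm_lt/(_ _ e0) := cvg_geometric c a1'.
apply: filterS => k /=; rewrite mulrC; apply: le_lt_trans; exact: ler_norm.
Qed.

Lemma near_exprM_gt (R : realType) (a c B : R) :
  1 < a -> 0 < c -> \forall k \near \oo, B < a ^+ k * c.
Proof.
move=> a1 c0; have a0 : 0 < a by exact: lt_trans a1.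
have := @near_exprM_lt _ a^-1 B c.
rewrite invr_ge0 ltW //= invf_lt1 // => /(_ a1 c0).
apply: filterS => k; rewrite exprVn mulrC ltr_pdivrMr ?exprn_gt0 //.
by rewrite mulrC.
Qed.

Lemma near_all_seq (I : eqType) (s : seq I) (P : I -> nat -> Prop) :
  (forall i, i \in s -> \forall k \near \oo, P i k) ->
  \forall k \near \oo, forall i, i \in s -> P i k.
Proof.
elim: s => [|j s IHs] Ps; first exact: nearW.
have Pj : \forall k \near \oo, P j k by apply: Ps; rewrite mem_head.
have {}IHs : \forall k \near \oo, forall i, i \in s -> P i k.
  by apply: IHs => i si; apply: Ps; rewrite inE si orbT.
apply: filterS2 Pj IHs => k Pjk Psk i.
by rewrite inE => /predU1P[->//|/Psk].
Qed.

(* Two absolute values with the same open unit ball are powers of each other; *)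
(* the common value at q pins the exponent to 1.                              *)
Lemma absolute_value_separate (R : realType) (K : fieldType) (v v' : K -> R)
    (q : K) :
  absolute_value v -> absolute_value v' -> 1 < v q -> v' q = v q -> v <> v' ->
  exists a, v a < 1 <= v' a.
Proof.
move=> av av' q1 qq nevv'; apply: contrapT => nsep; apply: nevv'.
have lt1 a : v a < 1 -> v' a < 1.
  move=> va; rewrite ltNge; apply/negP => v'a.
  by apply: nsep; exists a; rewrite va v'a.
have q0 : q != 0 by rewrite -(absv_gt0 av) (lt_trans _ q1).
have le a : a != 0 -> v' a <= v a.
  move=> a0; rewrite leNgt; apply/negP => vav'a.
  (* Multiplying a by a power of q scales both values by the same factor, so [v a] may be taken at
     least 1. *)
  wlog va1 : a a0 vav'a / 1 <= v a => [th|].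
    have va_gt0 : 0 < v a by rewrite absv_gt0.
    have [k _ /(_ k (leqnn k))] := near_exprM_gt 1 q1 va_gt0.
    move=> /= hk; apply: (th (q ^+ k * a)).
    - by rewrite mulf_neq0 // expf_neq0.
    - by rewrite (absvM av) (absvM av') (absvX av) (absvX av') qq
        ltr_pM2l // exprn_gt0 // (lt_trans _ q1).
    - by rewrite (absvM av) (absvX av) ltW.
  have va_gt0 : 0 < v a by rewrite absv_gt0.
  have rat1 : 1 < v' a / v a by rewrite ltr_pdivlMr ?mul1r.
  have [s _ /(_ s (leqnn s))/=] := near_exprM_gt (v q) rat1 ltr01.
  rewrite mulr1 expr_div_n ltr_pdivlMr ?exprn_gt0 // => hs.
  have exr : exists r, v a ^+ s < v q ^+ r.
    have [r _ /(_ r (leqnn r))/=] := near_exprM_gt (v a ^+ s) q1 ltr01.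
    by rewrite mulr1 => hr; exists r.
  (* With r+1 minimal, [v q ^+ r <= v a ^+ s < v q ^+ r.+1]. Then a^s / q^(r+1) lies in the open
     unit ball of v, but not in that of v', because s was chosen so that passing from v to v' gains
     more than a factor [v q]. *)
  have [[|r] hr minr] := ex_minnP exr.
    by move: hr; rewrite expr0 ltNge exprn_ege1.
  have rs : v q ^+ r <= v a ^+ s.
    by rewrite leNgt; apply/negP => /minr; rewrite ltnn.
  have qr0 : 0 < v q ^+ r.+1 by rewrite exprn_gt0 // (lt_trans _ q1).
  have := lt1 (a ^+ s / q ^+ r.+1).
  rewrite (absvM av) (absvM av') (absvV av) (absvV av').
  rewrite (absvX av) (absvX av') (absvX av) (absvX av') qq.
  rewrite !ltr_pdivrMr // !mul1r => /(_ hr).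
  apply/negP; rewrite -leNgt ltW // (le_lt_trans _ hs) //.
  by rewrite exprS ler_wpM2l // (absv_ge0 av).
apply/funext => a; have [->|a0] := eqVneq a 0.
  by rewrite (absv0 av) (absv0 av').
apply/le_anti; rewrite le // andbT.
have := le a^-1; rewrite invr_eq0 => /(_ a0).
by rewrite (absvV av) (absvV av') lef_pV2 // posrE absv_gt0.
Qed.

Section WeakApproximation.
Variables (R : realType) (K : fieldType) (I : eqType).
Variables (v : K -> R) (vs : I -> K -> R).
Hypotheses (av : absolute_value v) (avs : forall i, absolute_value (vs i)).

(** Artin-Whaples induction on s: an element z that works for the tail is combined with an element y
    that works for the new index m. *)
Lemma separating_element (s : seq I) :
  (exists z, 1 < v z) ->
  (forall i, i \in s -> exists z, 1 < v z /\ vs i z < 1) ->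
  exists z, 1 < v z /\ forall i, i \in s -> vs i z < 1.
Proof.
move=> [z0 z01]; elim: s => [|m s IHs] sep; first by exists z0.
have [|z [vz zs]] := IHs; first by move=> i si; apply: sep; rewrite inE si orbT.
have [|y [vy my]] := sep m; first by rewrite mem_head.
have z_i i : i \in s -> 0 <= vs i z < 1 by move=> /zs ->; rewrite absv_ge0.
(* A high power of z beats y on s and does not spoil the value of y at m. *)
have [mz|mz] := leP (vs m z) 1.
  have [k _ /(_ k (leqnn k)) hk] : \forall k \near \oo, forall i, i \in s ->
      vs i z ^+ k * vs i y < 1.
    by apply: near_all_seq => i /z_i ?; apply: near_exprM_lt.
  exists (z ^+ k * y); split=> [|i].
    rewrite (absvM av) (absvX av) (lt_le_trans vy) // ler_peMl ?absv_ge0 //.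
    by rewrite exprn_ege1 // ltW.
  rewrite inE (absvM (avs i)) (absvX (avs i)) => /predU1P[->|/hk//].
  by rewrite (le_lt_trans _ my) // ler_piMl ?absv_ge0 // exprn_ile1 ?absv_ge0.
(* Now z is large at m, so z^k is replaced by z^k / (1 + z^k), which tends to 1 at v and at m and to
   0 on s. The three bounds are the required inequalities for its product with y, after clearing 1 +
   z^k by the triangle inequality. *)
have [k _ /(_ k (leqnn k)) [hs hm hv]] : \forall k \near \oo,
    [/\ forall i, i \in s -> vs i z ^+ k * (1 + vs i y) < 1,
        1 < vs m z ^+ k * (1 - vs m y) & 1 < v z ^+ k * (v y - 1)].
  have h1 : \forall k \near \oo, forall i, i \in s ->
      vs i z ^+ k * (1 + vs i y) < 1.
    by apply: near_all_seq => i /z_i ?; apply: near_exprM_lt.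
  have h2 : \forall k \near \oo, 1 < vs m z ^+ k * (1 - vs m y).
    by apply: near_exprM_gt; rewrite ?subr_gt0.
  have h3 : \forall k \near \oo, 1 < v z ^+ k * (v y - 1).
    by apply: near_exprM_gt; rewrite ?subr_gt0.
  by apply: filterS3 h1 h2 h3.
have z10 : 1 + z ^+ k != 0.
  rewrite -(absv_gt0 (avs m)) addrC; apply: lt_le_trans (absv_leB (avs m) _ _).
  rewrite (absv1 (avs m)) (absvX (avs m)) subr_gt0 (lt_le_trans hm) //.
  by rewrite ler_piMr ?exprn_ge0 ?absv_ge0 // gerBl absv_ge0.
exists (z ^+ k / (1 + z ^+ k) * y); split=> [|i].
  rewrite !(absvM av) (absvV av) mulrAC ltr_pdivlMr ?absv_gt0 // mul1r.
  apply: le_lt_trans (absvD_le av _ _) _.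
  by rewrite (absv1 av) (absvX av) -ltrBrDr -[X in _ - X]mulr1 -mulrBr.
rewrite !(absvM (avs i)) (absvV (avs i)) mulrAC ltr_pdivrMr ?absv_gt0 // mul1r.
rewrite inE => /predU1P[->|si].
  rewrite addrC; apply: lt_le_trans (absv_leB (avs m) _ _).
  rewrite (absv1 (avs m)) (absvX (avs m)) ltrBrDr addrC -ltrBrDr.
  by rewrite -[X in X - _]mulr1 -mulrBr.
apply: lt_le_trans (absv_leB (avs i) _ _).
rewrite (absv1 (avs i)) (absvX (avs i)) ltrBrDr addrC.
by move: (hs i si); rewrite mulrDr mulr1.
Qed.

(** The element u = z^k / (1 + z^k) works for large k: u - 1 is -1 / (1 + z^k), small where z is
    large, and u is of the size of z^k where z is small. *)
Lemma approximate_idempotent (s : seq I) (z : K) (e : R) :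
  0 < e -> 1 < v z -> (forall i, i \in s -> vs i z < 1) ->
  exists u, v (u - 1) < e /\ forall i, i \in s -> vs i u < e.
Proof.
move=> e0 vz zs.
have z_i i : i \in s -> 0 <= vs i z < 1 by move=> /zs ->; rewrite absv_ge0.
have [k _ /(_ k (leqnn k)) [hs hv]] : \forall k \near \oo,
    (forall i, i \in s -> vs i z ^+ k * (1 + e) < e) /\ 1 + e^-1 < v z ^+ k * 1.
  have h1 : \forall k \near \oo, forall i, i \in s ->
      vs i z ^+ k * (1 + e) < e.
    by apply: near_all_seq => i /z_i ?; apply: near_exprM_lt.
  have h3 := near_exprM_gt (1 + e^-1) vz ltr01.
  by apply: filterS2 h1 h3.
move: hv; rewrite mulr1 => hv.
have v1z : e^-1 < v (1 + z ^+ k).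
  rewrite addrC; apply: lt_le_trans (absv_leB av _ _).
  by rewrite (absv1 av) (absvX av) ltrBrDr addrC.
have z10 : 1 + z ^+ k != 0 by rewrite -(absv_gt0 av) (lt_trans _ v1z) ?invr_gt0.
exists (z ^+ k / (1 + z ^+ k)); split=> [|i si].
  have -> : z ^+ k / (1 + z ^+ k) - 1 = - (1 + z ^+ k)^-1 by field.
  by rewrite (absvN av) (absvV av) -[e]invrK ltf_pV2 // posrE ?invr_gt0 // absv_gt0.
rewrite (absvM (avs i)) (absvV (avs i)) ltr_pdivrMr ?absv_gt0 //.
have : e * (1 - vs i z ^+ k) <= e * vs i (1 + z ^+ k).
  rewrite ler_pM2l // -(absvX (avs i)) -[X in X - _](absv1 (avs i)).
  exact: absv_leB.
apply: lt_le_trans; rewrite (absvX (avs i)).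
by move: (hs i si); rewrite mulrDr mulr1 mulrBr mulr1 [e * _]mulrC ltrBrDr.
Qed.

End WeakApproximation.

(** * Bases of a completion *)

Section Sequences.
Variables (R : realType) (F : fieldType) (v : F -> R).
Hypothesis av : absolute_value v.
Implicit Types u c : nat -> F.

Lemma null_seqP u :
  null_seq v u <-> forall e : R, 0 < e -> \forall k \near \oo, v (u k) < e.
Proof.
split=> [/cvgr0_norm_lt nu e /nu|nu]; last apply/cvgr0Pnorm_lt => e /nu.
  by apply: filterS => k; rewrite ger0_norm // absv_ge0.
by apply: filterS => k; rewrite ger0_norm // absv_ge0.
Qed.

Lemma null_seq_le u (f : nat -> R) (B : R) :
  (forall k, v (u k) <= f k * B) -> f k @[k --> \oo] --> (0 : R) ->
  null_seq v u.
Proof.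
move=> ub f0; apply: (@squeeze_cvgr _ _ _ _ (fun=> 0) (fun k => f k * B)).
- by apply: nearW => k; rewrite absv_ge0 //= ub.
- exact: cvg_cst.
- by rewrite -[X in _ --> X](mul0r B); apply: cvgM => //; apply: cvg_cst.
Qed.

Lemma null_seqD u c : null_seq v u -> null_seq v c ->
  null_seq v (fun k => u k + c k).
Proof.
move=> u0 c0.
have uc0 : v (u k) + v (c k) @[k --> \oo] --> (0 : R).
  by rewrite -[X in _ --> X](addr0 0); apply: cvgD.
by apply: (null_seq_le (B := 1)) uc0 => k; rewrite mulr1; apply: absvD_le.
Qed.

Lemma null_seq_sum I (r : seq I) (u : I -> nat -> F) :
  (forall i, null_seq v (u i)) -> null_seq v (fun k => \sum_(i <- r) u i k).
Proof.
move=> u0; elim: r => [|i r IHr].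
  by apply/null_seqP => e e0; apply: nearW => k; rewrite big_nil (absv0 av).
under eq_fun do rewrite big_cons; exact: null_seqD.
Qed.

Lemma cauchy_seq_bounded u : cauchy_seq v u ->
  exists B : R, 0 < B /\ \forall k \near \oo, v (u k) <= B.
Proof.
move=> /(_ 1 ltr01)[N cu]; exists (1 + v (u N)); split.
  by rewrite ltr_wpDr ?absv_ge0.
exists N => // k /= Nk; rewrite -lerBlDr.
apply: le_trans (ltW (cu k N Nk (leqnn N))).
by rewrite -(absvN av (u N)); apply: absv_leB.
Qed.

Lemma null_seqM c u : cauchy_seq v c -> null_seq v u ->
  null_seq v (fun k => c k * u k).
Proof.
move=> /cauchy_seq_bounded[B [B0 cB]] /null_seqP u0; apply/null_seqP => e e0.
have := u0 (e / B); rewrite divr_gt0 // => /(_ isT); apply: filterS2 cB => k.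
move=> ck uk; rewrite (absvM av) (le_lt_trans (ler_wpM2r _ ck)) ?absv_ge0 //.
by rewrite mulrC -ltr_pdivlMr.
Qed.

Lemma cauchy_seq_cst x : cauchy_seq v (fun=> x).
Proof. by move=> e e0; exists 0%N => m n _ _; rewrite subrr (absv0 av). Qed.

Lemma cauchy_seqD u c : cauchy_seq v u -> cauchy_seq v c ->
  cauchy_seq v (fun k => u k + c k).
Proof.
move=> cu cc e e0; have e20 : 0 < e / 2 by rewrite divr_gt0.
have [N1 h1] := cu _ e20; have [N2 h2] := cc _ e20.
exists (maxn N1 N2) => m n; rewrite !geq_max => /andP[m1 m2] /andP[n1 n2].
rewrite opprD addrACA (le_lt_trans (absvD_le av _ _)) // (splitr e).
by rewrite ltrD ?h1 ?h2.
Qed.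

Lemma cauchy_seqM u c : cauchy_seq v u -> cauchy_seq v c ->
  cauchy_seq v (fun k => u k * c k).
Proof.
move=> cu cc e e0.
have [B [B0 [N3 _ uB]]] := cauchy_seq_bounded cu.
have [C [C0 [N4 _ cC]]] := cauchy_seq_bounded cc.
have [|N1 h1] := cu (e / 2 / C); first by rewrite !divr_gt0.
have [|N2 h2] := cc (e / 2 / B); first by rewrite !divr_gt0.
exists (maxn (maxn N1 N2) (maxn N3 N4)) => m n.
rewrite !geq_max => /andP[/andP[m1 m2] /andP[m3 m4]].
move=> /andP[/andP[n1 n2] /andP[n3 n4]].
have -> : u m * c m - u n * c n = (u m - u n) * c m + u n * (c m - c n) by ring.
rewrite (le_lt_trans (absvD_le av _ _)) // !(absvM av) (splitr e) ltrD //.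
  rewrite (le_lt_trans (ler_wpM2l _ (cC m m4))) ?absv_ge0 //.
  by rewrite -ltr_pdivlMr // h1.
rewrite (le_lt_trans (ler_wpM2r _ (uB n n3))) ?absv_ge0 //.
by rewrite mulrC -ltr_pdivlMr // h2.
Qed.

Lemma cauchy_seq_sum I (r : seq I) (u : I -> nat -> F) :
  (forall i, cauchy_seq v (u i)) -> cauchy_seq v (fun k => \sum_(i <- r) u i k).
Proof.
move=> cu; elim: r => [|i r IHr].
  by under eq_fun do rewrite big_nil; apply: cauchy_seq_cst.
under eq_fun do rewrite big_cons; exact: cauchy_seqD.
Qed.

End Sequences.

Section CompletionBasis.
Variables (R : realType) (K : fieldExtType rat) (v : K -> R).
Hypothesis av : absolute_value v.

Let in_algM (a b : rat) : (a * b)%:A = a%:A * b%:A :> K.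
Proof. by rewrite -in_algE rmorphM. Qed.

(** Rewriting e in terms of b and back shows that the rows of I - AB are relations between the e_i
    modulo null sequences. Freeness makes every entry null, hence also the trace, which is the
    sequence of the conclusion. *)
Lemma completion_basis_product (m d : nat) (e : 'I_m -> nat -> K)
    (b : 'I_d -> nat -> K) (A : 'I_m -> 'I_d -> nat -> rat)
    (B : 'I_d -> 'I_m -> nat -> rat) :
  completion_basis v e ->
  (forall i j, cauchy_seq v (fun k => (A i j k)%:A)) ->
  (forall i j, cauchy_seq v (fun k => (B i j k)%:A)) ->
  (forall i, null_seq v (fun k => e i k - \sum_j A i j k *: b j k)) ->
  (forall j, null_seq v (fun k => b j k - \sum_i B j i k *: e i k)) ->
  null_seq v (fun k => (m%:R - \sum_i \sum_j A i j k * B j i k)%:A).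
Proof.
move=> [_ _ free] cA cB eA bB.
pose D i l k := (i == l)%:R - \sum_j A i j k * B j l k.
have DE i l k :
    (D i l k)%:A = (i == l)%:R%:A + \sum_j (- 1)%:A * ((A i j k)%:A * (B j l k)%:A) :> K.
  rewrite /D scalerBl scaler_suml -sumrN; congr (_ + _).
  by apply: eq_bigr => j _; rewrite in_algM scaleN1r mulN1r.
have cD i l : cauchy_seq v (fun k => (D i l k)%:A).
  under eq_fun do rewrite DE; apply: cauchy_seqD => //.
    exact: cauchy_seq_cst.
  apply: cauchy_seq_sum => // j; apply: cauchy_seqM => //.
    exact: cauchy_seq_cst.
  exact: cauchy_seqM.
have nD i l : null_seq v (fun k => (D i l k)%:A).
  apply: (free (D i)) => //.
  have -> : (fun k => \sum_l D i l k *: e l k) = (fun k =>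
      (e i k - \sum_j A i j k *: b j k) +
      \sum_j (A i j k)%:A * (b j k - \sum_l B j l k *: e l k)).
    apply/funext => k.
    under [X in _ = _ + X]eq_bigr do rewrite mulrBr -scalerAl mul1r.
    rewrite sumrB addrA subrK.
    under eq_bigr do rewrite scalerBl scaler_suml.
    rewrite sumrB (bigD1 i) //= eqxx scale1r big1 ?addr0; last first.
      by move=> l0 /negPf; rewrite eq_sym => ->; rewrite scale0r.
    congr (_ - _); rewrite exchange_big; apply: eq_bigr => j _ /=.
    by rewrite -scalerAl mul1r scaler_sumr; apply: eq_bigr => ? _; rewrite scalerA.
  apply: null_seqD => //; apply: null_seq_sum => // j.
  exact: null_seqM.
have -> : (fun k => (m%:R - \sum_i \sum_j A i j k * B j i k)%:A : K) =
    (fun k => \sum_i (D i i k)%:A).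
  apply/funext => k; rewrite -scaler_suml sumrB.
  under [in RHS]eq_bigr do rewrite eqxx.
  by rewrite sumr_const card_ord.
exact: null_seq_sum.
Qed.

(* If A and B are the change of basis matrices, then AB and BA tend to the    *)
(* identity and have the same trace, so m - d is a null sequence.             *)
Lemma completion_basis_uniq (m d : nat) (e : 'I_m -> nat -> K)
    (b : 'I_d -> nat -> K) :
  completion_basis v e -> completion_basis v b -> m = d.
Proof.
move=> be bb; have [ce spe _] := be; have [cb spb _] := bb.
have /choice[A hA] : forall i, exists a : 'I_d -> nat -> rat,
    (forall j, cauchy_seq v (fun k => (a j k)%:A)) /\
    null_seq v (fun k => e i k - \sum_j a j k *: b j k).
  by move=> i; have [a ca na] := spb _ (ce i); exists a.
have /choice[B hB] : forall j, exists a : 'I_m -> nat -> rat,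
    (forall i, cauchy_seq v (fun k => (a i k)%:A)) /\
    null_seq v (fun k => b j k - \sum_i a i k *: e i k).
  by move=> j; have [a ca na] := spe _ (cb j); exists a.
have h1 := completion_basis_product be (fun i => (hA i).1) (fun j => (hB j).1)
  (fun i => (hA i).2) (fun j => (hB j).2).
have h2 := completion_basis_product bb (fun j => (hB j).1) (fun i => (hA i).1)
  (fun j => (hB j).2) (fun i => (hA i).2).
(* In the difference of the two traces AB and BA cancel, and the null sequence left is the constant
   m - d. *)
have := null_seqD av h1 (null_seqM av (cauchy_seq_cst av (-1)) h2).
under eq_fun => k.
  rewrite [X in _ + _ * (_ - X)%:A]exchange_big /=.
  under [X in _ + _ * (_ - X)%:A]eq_bigr do under eq_bigr do rewrite mulrC.
  rewrite mulN1r -scaleNr -scalerDl opprB addrA subrK.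
  over.
move=> /cvg_lim; rewrite lim_cst // => /(_ (@Rhausdorff _)) /eqP.
rewrite (absv_eq0 av) -[_%:A]in_algE fmorph_eq0 subr_eq0 eqr_nat.
by move=> /eqP.
Qed.

Lemma local_degree_basis (d : nat) (b : 'I_d -> nat -> K) :
  completion_basis v b -> local_degree v = d.
Proof.
move=> bb; apply: xget_subset1; first by exists b.
move=> m1 m2 [e1 b1] [e2 b2]; exact: completion_basis_uniq b1 b2.
Qed.

End CompletionBasis.

(** * Places of a number field and their local degrees *)

Lemma Vandermonde_unit (F : fieldType) (d : nat) (a : 'I_d -> F) :
  injective a -> Vandermonde d (\row_k a k) \in unitmx.
Proof.
move=> inja; rewrite unitmxE det_Vandermonde unitfE prodf_seq_neq0.
apply/allP => i _ /=; rewrite prodf_seq_neq0; apply/allP => j _ /=.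
apply/implyP => ij; rewrite !mxE subr_eq0 (inj_eq inja).
by apply: contraTneq ij => ->; rewrite ltnn.
Qed.

(** Cramer's rule: the entries of the inverse are cofactors over the determinant. On a singular
    matrix [invmx] returns its argument. *)
Lemma invmx_over (F : fieldType) (S : divringClosed F) (d : nat) (A : 'M[F]_d) :
  (forall i j, A i j \in S) -> forall i j, invmx A i j \in S.
Proof.
move=> SA i j; rewrite /invmx; case: ifP => // _.
have Sdet m (B : 'M[F]_m) : (forall i j, B i j \in S) -> \det B \in S.
  move=> SB; rewrite rpred_sum // => s _.
  by rewrite rpredMsign rpred_prod.
rewrite !mxE rpredM ?rpredV ?Sdet // rpredMsign; apply: Sdet => i' j'.
by rewrite !mxE.
Qed.

Section RationalClosure.
Variables (R : realType) (w : algC -> R).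
Hypothesis aw : absolute_value w.

(** The algebraic numbers that lie in the closure of Q for w. This field stands for Q_p inside
    [algC]. *)
Definition rat_closure : {pred algC} :=
  [pred a | `[< forall e : R, 0 < e -> exists q : rat, w (a - ratr q) < e >]].

Lemma rat_closureP a :
  reflect (forall e : R, 0 < e -> exists q : rat, w (a - ratr q) < e)
          (a \in rat_closure).
Proof. exact: asboolP. Qed.

Lemma rat_closure_divring : divring_closed rat_closure.
Proof.
have M a b : a \in rat_closure -> b \in rat_closure -> a * b \in rat_closure.
  move=> /rat_closureP ca /rat_closureP cb; apply/rat_closureP => e e0.
  have wa0 : 0 < w a + 1 by rewrite ltr_wpDl ?absv_ge0.
  have wb0 : 0 < w b + 1 by rewrite ltr_wpDl ?absv_ge0.
  have [|r hr] := cb (Num.min 1 (e / 2 / (w a + 1))).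
    by rewrite lt_min ltr01 !divr_gt0.
  have [|q hq] := ca (e / 2 / (w b + 1)); first by rewrite !divr_gt0.
  move: hr; rewrite lt_min => /andP[hr1 hr2].
  exists (q * r); rewrite rmorphM.
  have -> : a * b - ratr q * ratr r =
      a * (b - ratr r) + (a - ratr q) * ratr r by ring.
  rewrite (le_lt_trans (absvD_le aw _ _)) // (absvM aw a) (absvM aw (a - _)).
  rewrite (splitr e) ltrD //.
    rewrite (le_lt_trans (_ : _ <= (w a + 1) * w (b - ratr r))) //.
      by rewrite ler_wpM2r ?absv_ge0 // lerDl.
    by rewrite mulrC -ltr_pdivlMr.
  rewrite (le_lt_trans (_ : _ <= w (a - ratr q) * (w b + 1))) //.
    rewrite ler_wpM2l ?absv_ge0 // -lerBlDl (le_trans _ (ltW hr1)) //.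
    by rewrite (absv_distrC aw) -(absvN aw b) absv_leB.
  by rewrite -ltr_pdivlMr.
split=> [|a b /rat_closureP ca /rat_closureP cb|a b ca cb].
- apply/rat_closureP => e e0; exists 1.
  by rewrite rmorph1 subrr (absv0 aw).
- apply/rat_closureP => e e0; have e20 : 0 < e / 2 by rewrite divr_gt0.
  have [q hq] := ca _ e20; have [r hr] := cb _ e20.
  exists (q - r); rewrite rmorphB.
  have -> : a - b - (ratr q - ratr r) = (a - ratr q) - (b - ratr r) by ring.
  by rewrite (le_lt_trans (absvB_le aw _ _)) // (splitr e) ltrD.
apply: M => //; have [->|b0] := eqVneq b 0.
  by apply/rat_closureP => e e0; exists 0; rewrite invr0 rmorph0 subrr (absv0 aw).
apply/rat_closureP => e e0; move/rat_closureP: cb => cb.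
have wb : 0 < w b by rewrite absv_gt0.
(* The first bound keeps [w (ratr q)] above [w b / 2]; the second is the error allowed once the
   difference of inverses is put over the denominator [b * ratr q]. *)
have [|q] := cb (Num.min (w b / 2) (e * (w b * (w b / 2)))).
  by rewrite lt_min !(divr_gt0, mulr_gt0).
rewrite lt_min => /andP[hq1 hq2]; exists q^-1.
have wq : w b / 2 < w (ratr q).
  have := absv_leB aw b (- (b - ratr q)).
  have -> : b - (b - ratr q) = ratr q by ring.
  rewrite (absvN aw); apply: lt_le_trans.
  by lra.
have q0 : ratr q != 0 :> algC.
  by rewrite -(absv_gt0 aw) (lt_trans _ wq) // divr_gt0.
rewrite fmorphV.
have -> : b^-1 - (ratr q)^-1 = - (b - ratr q) / (b * ratr q) by field; apply/andP.
rewrite (absvM aw) (absvN aw) (absvV aw) (absvM aw) ltr_pdivrMr; last first.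
  by rewrite mulr_gt0 ?absv_gt0.
by rewrite (lt_trans hq2) // ltr_pM2l // ltr_pM2l.
Qed.

HB.instance Definition _ :=
  GRing.isDivringClosed.Build algC rat_closure rat_closure_divring.

End RationalClosure.

Section PlacesOverPlace.
Variables (R : realType) (K : fieldExtType rat) (n : nat).
Variables (sg : 'I_n -> {rmorphism K -> algC}) (g : K).
Hypothesis sg_inj : injective (fun k => sg k g).
Hypothesis g_span : forall y, exists c : 'rV[rat]_n, y = \sum_i c 0 i *: g ^+ i.
Variables (w : algC -> R) (v : K -> R).
Hypotheses (aw : absolute_value w) (av : absolute_value v).
Hypothesis vw : forall q, v q%:A = w (ratr q).
Hypothesis w_nontriv : exists q : rat, 1 < w (ratr q).

Let V := Vandermonde n (\row_k sg k g).

Lemma embedding_coords y (c : 'rV[rat]_n) : y = \sum_i c 0 i *: g ^+ i ->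
  (\row_k sg k y) = map_mx ratr c *m V.
Proof.
move=> ->; apply/rowP => k; rewrite !mxE rmorph_sum.
by apply: eq_bigr => i _; rewrite rmorphZ_num !mxE rmorphXn.
Qed.

(** Multiplication by y has a rational matrix M on the powers of g, and the Vandermonde matrix V
    conjugates M to the diagonal matrix of the embeddings of y. *)
Lemma embedding_trace_rat y : exists q : rat, \sum_k sg k y = ratr q.
Proof.
have /choice[c hc] := fun i : 'I_n => g_span (y * g ^+ i).
pose M := \matrix_(i < n) c i.
exists (\tr M).
have MV : map_mx ratr M *m V = V *m diag_mx (\row_k sg k y).
  apply/row_matrixP => i; rewrite row_mul -map_row rowK -(embedding_coords (hc i)).
  by apply/rowP => k; rewrite mul_mx_diag !mxE rmorphM rmorphXn mulrC.
have Vu : V \in unitmx by apply: Vandermonde_unit.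
rewrite -trace_map_mx -[map_mx _ M](mulmxK Vu) MV -mulmxA mxtrace_mulC.
rewrite -mulmxA mulVmx // mulmx1 mxtrace_diag.
by apply: eq_bigr => k _; rewrite mxE.
Qed.

(** Each of the two places is separated from the other with one strict inequality; the quotient of
    the two elements is strict on both sides. *)
Lemma place_neq_separate (v1 v2 : K -> R) :
  absolute_value v1 -> absolute_value v2 ->
  (forall q, v1 q%:A = w (ratr q)) -> (forall q, v2 q%:A = w (ratr q)) ->
  v1 <> v2 -> exists z, 1 < v1 z /\ v2 z < 1.
Proof.
move=> av1 av2 vw1 vw2 ne; have [q hq] := w_nontriv.
have [||a /andP[a1 a2]] := absolute_value_separate (q := q%:A) av1 av2 _ _ ne;
  rewrite ?vw1 ?vw2 //.
have [||b /andP[b1 b2]] := absolute_value_separate (q := q%:A) av2 av1 _ _ (nesym ne);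
  rewrite ?vw1 ?vw2 //.
have a0 : a != 0 by rewrite -(absv_gt0 av2) (lt_le_trans _ a2).
exists (b / a); rewrite (absvM av1) (absvM av2) (absvV av1) (absvV av2).
rewrite ltr_pdivlMr ?absv_gt0 // ltr_pdivrMr ?absv_gt0 // !mul1r.
by split; [apply: lt_le_trans b2|apply: lt_le_trans a2].
Qed.

Let asg k : absolute_value (w \o sg k).
Proof. exact: absolute_value_comp. Qed.

Let sgw k q : (w \o sg k) q%:A = w (ratr q).
Proof. by rewrite /= rmorphZ_num rmorph1 mulr1. Qed.

Let nontriv_v : exists z, 1 < v z.
Proof. by have [q hq] := w_nontriv; exists q%:A; rewrite vw. Qed.

(** The rational coordinates of y on the powers of g are linear in the embeddings of y, through the
    inverse of V, and v agrees with w on rationals. *)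
Lemma place_le_embeddings : exists B : 'I_n -> R,
  forall y, v y <= \sum_k w (sg k y) * B k.
Proof.
pose U := invmx V; exists (fun k => \sum_i w (U k i) * v (g ^+ i)) => y.
have [c yc] := g_span y.
have Vu : V \in unitmx by apply: Vandermonde_unit.
have cE : map_mx ratr c = (\row_k sg k y) *m U.
  by rewrite (embedding_coords yc) mulmxK.
rewrite {1}yc (le_trans (absv_sum_le av _ _ _)) //.
under [leRHS]eq_bigr do rewrite mulr_sumr.
rewrite exchange_big; apply: ler_sum => i _ /=.
rewrite -[c 0 i *: _]mulr_algl (absvM av) vw.
have -> : ratr (c 0 i) = \sum_k sg k y * U k i :> algC.
  by move/rowP: cE => /(_ i); rewrite !mxE => ->; apply: eq_bigr => k _; rewrite mxE.
under [leRHS]eq_bigr do rewrite mulrA.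
rewrite -mulr_suml ler_wpM2r ?absv_ge0 // (le_trans (absv_sum_le aw _ _ _)) //.
by apply: ler_sum => k _; rewrite (absvM aw).
Qed.

(** Otherwise some z is large for v and small under every embedding, and its powers violate the
    linear bound of [place_le_embeddings]. *)
Lemma place_is_embedding : exists k, w \o sg k = v.
Proof.
apply: contrapT => /forallNP nv.
have [|z [vz zs]] :=
    separating_element av asg (s := enum 'I_n) nontriv_v.
  move=> k _; apply: place_neq_separate => // e; exact: nv k (esym e).
have [B hB] := place_le_embeddings.
(* The n terms of the bound then add up to at most n / (n + 1), which is below 1. *)
have [m _ /(_ m (leqnn m)) hm] : \forall m \near \oo, forall k, k \in enum 'I_n ->
    (w \o sg k) z ^+ m * B k < n.+1%:R^-1.
  apply: near_all_seq => k kI; apply: near_exprM_lt; last by rewrite invr_gt0.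
  by rewrite absv_ge0 //= zs.
have : v (z ^+ m) < 1.
  apply: le_lt_trans (hB _) _.
  apply: (@le_lt_trans _ _ (\sum_(k < n) n.+1%:R^-1)).
    apply: ler_sum => k _; rewrite rmorphXn (absvX aw); apply/ltW/hm.
    by rewrite mem_enum.
  by rewrite sumr_const card_ord -[_ *+ n]mulr_natl ltr_pdivrMr // mul1r ltr_nat.
by rewrite (absvX av) ltNge exprn_ege1 // ltW.
Qed.

Definition place_embeddings : {set 'I_n} := [set k | `[< w \o sg k = v >]].

Local Notation S := place_embeddings.
Local Notation d := #|S|.

Lemma place_embeddingsP k : reflect (w \o sg k = v) (k \in S).
Proof. by rewrite inE; apply: asboolP. Qed.

Let wS y k : k \in S -> w (sg k y) = v y.
Proof. by move=> /place_embeddingsP <-. Qed.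

(* The rational trace of u * y approximates the partial trace of y when u is  *)
(* close to 1 at v and to 0 at the other places.                              *)
Lemma local_trace_rat_closure y : \sum_(k in S) sg k y \in rat_closure w.
Proof.
apply/rat_closureP => e e0.
pose C := \sum_k w (sg k y) + 1.
have C0 : 0 < C by rewrite ltr_wpDl // sumr_ge0 // => k _; rewrite absv_ge0.
have [|z [vz zs]] := separating_element av asg (s := enum (~: S)) nontriv_v.
  move=> k; rewrite mem_enum inE => /place_embeddingsP nv.
  by apply: place_neq_separate => // e1; apply: nv.
have [|u [u1 us]] := approximate_idempotent av asg (e := e / C) _ vz zs.
  by rewrite divr_gt0.
have [q hq] := embedding_trace_rat (u * y); exists q; rewrite -hq.
rewrite [X in _ - X](bigID (mem S)) /= opprD addrA -sumrB -sumrN.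
apply: (@le_lt_trans _ _ (\sum_k (e / C) * w (sg k y))); last first.
  by rewrite -mulr_sumr mulrAC ltr_pdivrMr // ltr_pM2l // /C ltrDl.
rewrite [leRHS](bigID (mem S)) /= (le_trans (absvD_le aw _ _)) // lerD //.
  rewrite (le_trans (absv_sum_le aw _ _ _)) // ler_sum // => k kS.
  rewrite rmorphM -{1}[sg k y]mul1r -mulrBl (absvM aw) ler_wpM2r ?absv_ge0 //.
  by rewrite (absv_distrC aw) -(rmorph1 (sg k)) -rmorphB wS // ltW.
rewrite (le_trans (absv_sum_le aw _ _ _)) // ler_sum // => k kS.
rewrite (absvN aw) rmorphM (absvM aw) ler_wpM2r ?absv_ge0 // ltW //.
by apply: us; rewrite mem_enum inE.
Qed.

Let s (j : 'I_d) : {rmorphism K -> algC} := sg (enum_val j).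
Let W := Vandermonde d (\row_j s j g).
Let ws y j : w (s j y) = v y.
Proof. by rewrite wS // enum_valP. Qed.

Let Wu : W \in unitmx.
Proof. by apply: Vandermonde_unit => i j /sg_inj/enum_val_inj. Qed.

(** The coordinates of y on 1, g, ..., g^(d-1) over the closure of Q, obtained by interpolation at
    the images of g under the d embeddings that induce v. *)
Let coord y := (\row_j s j y) *m invmx W.

Let coordW y j : s j y = \sum_i coord y 0 i * s j g ^+ i.
Proof.
have : \row_j s j y = coord y *m W by rewrite mulmxKV.
by move=> /rowP/(_ j); rewrite !mxE => ->; apply: eq_bigr => i _; rewrite !mxE.
Qed.

Let coordB x y i : coord (x - y) 0 i = coord x 0 i - coord y 0 i.
Proof.
rewrite !mxE -sumrB; apply: eq_bigr => j _.
by rewrite !mxE rmorphB mulrBl.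
Qed.

Let coord_le : exists B : 'I_d -> R, forall y i, w (coord y 0 i) <= v y * B i.
Proof.
exists (fun i => \sum_j w (invmx W j i)) => y i; rewrite mxE mulr_sumr.
rewrite (le_trans (absv_sum_le aw _ _ _)) // ler_sum // => j _.
by rewrite (absvM aw) mxE ws.
Qed.

(** Multiplying by the transpose of W turns both the row of embeddings and W itself into arrays of
    partial traces, which lie in [rat_closure w]; Cramer's rule stays in that field. *)
Let coord_rat_closure y i : coord y 0 i \in rat_closure w.
Proof.
pose T := W *m W^T.
have Tu : T \in unitmx by rewrite unitmx_mul Wu unitmx_tr.
have -> : coord y = ((\row_j s j y) *m W^T) *m invmx T.
  apply: (canRL (mulmxK Tu)); rewrite /T mulmxA; congr (_ *m _).
  by rewrite mulmxKV.
rewrite mxE rpred_sum // => j _; rewrite rpredM //; last first.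
  apply: invmx_over => i1 i2.
  suff -> : T i1 i2 = \sum_(k in S) sg k (g ^+ (i1 + i2)).
    exact: local_trace_rat_closure.
  rewrite mxE [RHS]big_enum_val; apply: eq_bigr => k _ /=.
  by rewrite !mxE rmorphXn exprD.
suff -> : (\row_j s j y *m W^T) 0 j = \sum_(k in S) sg k (y * g ^+ j).
  exact: local_trace_rat_closure.
rewrite mxE [RHS]big_enum_val; apply: eq_bigr => k _ /=.
by rewrite !mxE rmorphM rmorphXn.
Qed.

(** The value v is computed through one embedding that induces it, provided by
    [place_is_embedding]. *)
Let v_coord y (c : 'I_d -> rat) :
  v (y - \sum_i c i *: g ^+ i) <=
  \sum_i w (coord y 0 i - ratr (c i)) * v g ^+ i.
Proof.
have [k kS] := place_is_embedding.
have {}kS : k \in S by apply/place_embeddingsP.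
pose j := enum_rank_in kS k; rewrite -(ws _ j) rmorphB coordW rmorph_sum -sumrB.
rewrite (le_trans (absv_sum_le aw _ _ _)) // ler_sum // => i _.
by rewrite rmorphZ_num rmorphXn -mulrBl (absvM aw) (absvX aw) ws.
Qed.

Let coord_poly (c : 'I_d -> rat) i : coord (\sum_i c i *: g ^+ i) 0 i = ratr (c i).
Proof.
rewrite /coord; have -> : \row_j s j (\sum_i c i *: g ^+ i) = (\row_i ratr (c i)) *m W.
  apply/rowP => j; rewrite !mxE rmorph_sum; apply: eq_bigr => l _.
  by rewrite rmorphZ_num !mxE rmorphXn.
by rewrite mulmxK // mxE.
Qed.

(** The k-th term of a Cauchy sequence is expanded by [coord], and each coordinate is replaced by a
    rational within 1/(k+1). The bound [coord_le] makes these rationals Cauchy sequences, and it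
    also gives freeness. *)
Lemma place_completion_basis :
  completion_basis v (fun (i : 'I_d) (_ : nat) => g ^+ i).
Proof.
have [B hB] := coord_le.
have ratB (a b : rat) : v (a%:A - b%:A) = w (ratr a - ratr b).
  by rewrite -scalerBl vw rmorphB.
have harm : (k.+1%:R^-1 : R) @[k --> \oo] --> (0 : R) by exact: cvg_harmonic.
split=> [i|u cu|c cc nc i]; first exact: cauchy_seq_cst.
- have /choice[c hc] : forall ik : 'I_d * nat, exists q : rat,
      w (coord (u ik.2) 0 ik.1 - ratr q) < ik.2.+1%:R^-1.
    by move=> [i k]; have /rat_closureP := coord_rat_closure (u k) i; apply.
  exists (fun i k => c (i, k)) => [i e e0|].
  + have e30 : 0 < e / 3 by rewrite divr_gt0.
    have B10 : 0 < `|B i| + 1 by rewrite ltr_wpDl.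
    have [|N1 h1] := cu (e / 3 / (`|B i| + 1)); first by rewrite !divr_gt0.
    have /cvgr0_norm_lt/(_ _ e30)[N2 _ h2] := harm.
    have {}h2 k : (N2 <= k)%N -> k.+1%:R^-1 < e / 3.
      by move=> /h2 /=; rewrite ger0_norm.
    exists (maxn N1 N2) => k l; rewrite !geq_max => /andP[k1 k2] /andP[l1 l2].
    rewrite ratB.
    have -> : ratr (c (i, k)) - ratr (c (i, l)) =
        - (coord (u k) 0 i - ratr (c (i, k))) + coord (u k - u l) 0 i
        + (coord (u l) 0 i - ratr (c (i, l))) by rewrite coordB; ring.
    have -> : e = e / 3 + e / 3 + e / 3 by field.
    rewrite (le_lt_trans (absvD_le aw _ _)) // ltrD //.
      rewrite (le_lt_trans (absvD_le aw _ _)) // ltrD //.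
    * by rewrite (absvN aw) (lt_trans (hc (i, k))) ?h2.
    * rewrite (le_lt_trans (hB _ _)) //.
      rewrite (le_lt_trans (_ : _ <= v (u k - u l) * (`|B i| + 1))) //.
        by rewrite ler_wpM2l ?absv_ge0 // (le_trans (ler_norm _)) // lerDl.
      by rewrite -ltr_pdivlMr // h1.
    * by rewrite (lt_trans (hc (i, l))) ?h2.
  + apply: (@null_seq_le _ _ _ av _ (fun k => k.+1%:R^-1)
      (\sum_(i < d) v g ^+ i)) => // k.
    rewrite (le_trans (v_coord _ _)) // mulr_sumr ler_sum // => i _.
    by rewrite ler_wpM2r ?exprn_ge0 ?absv_ge0 // ltW // (hc (i, k)).
- apply: (@null_seq_le _ _ _ av _ _ (B i)) nc => // k.
  by rewrite vw -(coord_poly (c^~ k)) hB.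
Qed.

Lemma local_degree_embeddings : local_degree v = #|place_embeddings|.
Proof. exact: local_degree_basis place_completion_basis. Qed.

End PlacesOverPlace.

(** * Extension of the places of Q to algC *)

Lemma ratr_frac (F : numFieldType) (a b : nat) :
  ratr (a%:R / b%:R) = a%:R / b%:R :> F.
Proof. by rewrite fmorph_div !rmorph_nat. Qed.

(** * The real absolute value on [algC] *)

Section ArchimedeanPlace.
Variable R : realType.

(** The norm of [algC] takes its values in [algC]; the Dedekind cut of rationals below it carries it
    to R. *)
Let below (x : algC) : set R := [set ratr q | q in [set q : rat | ratr q <= `|x|]].

Definition real_abs (x : algC) : R := sup (below x).

Lemma ratr_le_real_abs x (q : rat) : ratr q <= `|x| -> ratr q <= real_abs x.
Proof.
move=> qx; apply: ub_le_sup; last by exists q.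
exists (Num.bound `|x|)%:R => _ [r /= rx <-].
have := le_lt_trans rx (archi_boundP (normr_ge0 x)).
by rewrite -[X in _ < X]ratr_nat ltr_rat => /ltW; rewrite -(ler_rat R) ratr_nat.
Qed.

Let below0 x : below x 0.
Proof. by exists 0; rewrite /= ?rmorph0. Qed.

Lemma real_abs_le x (B : R) : 0 <= B ->
  (forall q, 0 <= q -> ratr q <= `|x| -> ratr q <= B) -> real_abs x <= B.
Proof.
move=> B0 xB; apply: ge_sup; first by exists 0.
move=> _ [q /= qx <-]; have [q0|q0] := leP 0 q; first exact: xB.
by rewrite (le_trans _ B0) // lerq0 ltW.
Qed.

Lemma real_abs_le_ratr x (q : rat) : `|x| <= ratr q -> real_abs x <= ratr q.
Proof.
move=> xq; apply: real_abs_le => [|r r0 rx].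
  by rewrite ler0q -(ler0q algC) (le_trans _ xq).
by have := le_trans rx xq; rewrite !ler_rat.
Qed.

Lemma real_abs_ge0 x : 0 <= real_abs x.
Proof. by have := @ratr_le_real_abs x 0; rewrite !rmorph0; apply. Qed.

(** Truncating |x| N gives m/N <= |x| < (m+1)/N, with N chosen so that 1/N < e. *)
Lemma real_abs_approx x (e : R) : 0 < e ->
  exists2 q : rat, `|x| <= ratr q & ratr q <= real_abs x + e.
Proof.
move=> e0; set N := (Num.bound e^-1).+1.
have N0 : 0 < N%:R :> rat by rewrite ltr0n.
have Ne : N%:R^-1 < e.
  rewrite -[e]invrK ltf_pV2 ?posrE ?invr_gt0 ?ltr0n //.
  have e'0 : 0 <= e^-1 by rewrite invr_ge0 ltW.
  by rewrite (lt_trans (archi_boundP e'0)) // ltr_nat.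
have /truncn_itv/andP[h1 h2] : 0 <= `|x| * N%:R by rewrite mulr_ge0.
set m := Num.truncn _ in h1 h2.
exists (m.+1%:R / N%:R).
  by rewrite ratr_frac ler_pdivlMr ?ltr0n // ltW.
have : ratr (m%:R / N%:R) <= real_abs x.
  apply: ratr_le_real_abs.
  by rewrite ratr_frac ler_pdivrMr ?ltr0n.
rewrite !ratr_frac -natr1 mulrDl mul1r => hm.
by rewrite lerD // ltW.
Qed.

Lemma le_real_abs x (B : R) :
  (forall q, `|x| <= ratr q -> B <= ratr q) -> B <= real_abs x.
Proof.
move=> xB; apply/ler_addgt0Pr => e /(real_abs_approx x)[q /xB]; exact: le_trans.
Qed.

Lemma real_abs_absolute_value : absolute_value real_abs.
Proof.
have abs0 x : real_abs x = 0 <-> x = 0.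
  split=> [x0|->]; last first.
    apply/le_anti; rewrite real_abs_ge0 andbT.
    by have := @real_abs_le_ratr 0 0; rewrite normr0 !rmorph0; apply.
  apply/eqP; apply: contraPT x0 => x0; apply/eqP; rewrite gt_eqF //.
  pose N := (Num.bound `|x|^-1).
  have NxV : `|x|^-1 < N%:R by rewrite archi_boundP // invr_ge0.
  have N0 : (0 < N)%N by rewrite -(ltr0n algC) (le_lt_trans _ NxV) // invr_ge0.
  apply: (@lt_le_trans _ _ (ratr (1%:R / N%:R))).
    by rewrite ratr_frac divr_gt0 ?ltr0n.
  apply: ratr_le_real_abs; rewrite ratr_frac mul1r -[`|x|]invrK lef_pV2 ?ltW //.
    by rewrite posrE ltr0n.
  by rewrite posrE invr_gt0 normr_gt0.
split=> // [x|x y|x y]; first exact: real_abs_ge0.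
- have [->|x0] := eqVneq x 0.
    by rewrite mul0r (abs0 0).2 // mul0r.
  have [->|y0] := eqVneq y 0.
    by rewrite mulr0 (abs0 0).2 // mulr0.
  have gt0 z : z != 0 -> 0 < real_abs z.
    move=> z0; rewrite lt_neqAle real_abs_ge0 andbT eq_sym.
    by apply: contra_neqN z0 => /eqP/abs0.
  (* Each inequality is divided by one factor at a time, so that it only has to be checked on
     rational bounds q of |x| and r of |y|, where it reads off from [q * r]. *)
  apply/le_anti/andP; split.
    rewrite -ler_pdivrMr ?gt0 //; apply: le_real_abs => q qx.
    have q0 : 0 < q by rewrite -(ltr0q algC) (lt_le_trans _ qx) // normr_gt0.
    rewrite ler_pdivrMr ?gt0 // [ratr q * _]mulrC -ler_pdivrMr ?ltr0q //.
    apply: le_real_abs => r ry; rewrite ler_pdivrMr ?ltr0q // -rmorphM.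
    by apply: real_abs_le_ratr; rewrite normrM rmorphM mulrC ler_pM.
  rewrite -ler_pdivlMr ?gt0 //; apply: real_abs_le => [|q q0 qx].
    by rewrite divr_ge0 ?real_abs_ge0.
  have [->|qn0] := eqVneq q 0; first by rewrite rmorph0 divr_ge0 ?real_abs_ge0.
  have {qn0}q0 : 0 < q by rewrite lt_def qn0.
  rewrite ler_pdivlMr ?gt0 // [ratr q * _]mulrC -ler_pdivlMr ?ltr0q //.
  apply: real_abs_le => [|r r0 ry].
    by rewrite divr_ge0 ?real_abs_ge0 // ler0q ltW.
  rewrite ler_pdivlMr ?ltr0q // -rmorphM; apply: ratr_le_real_abs.
  by rewrite normrM rmorphM mulrC ler_pM // ler0q // ltW.
- apply/ler_addgt0Pr => e e0; have e20 : 0 < e / 2 by rewrite divr_gt0.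
  have [q qx hq] := real_abs_approx x e20.
  have [r ry hr] := real_abs_approx y e20.
  apply: (@le_trans _ _ (ratr (q + r))).
    apply: real_abs_le_ratr; rewrite rmorphD.
    by rewrite (le_trans (ler_normD _ _)) // lerD.
  by rewrite rmorphD (splitr e) addrACA lerD.
Qed.

Lemma real_abs_rat (q : rat) : real_abs (ratr q) = ratr `|q|.
Proof.
apply/le_anti/andP; split.
  by apply: real_abs_le_ratr; rewrite ratr_norm.
by apply: ratr_le_real_abs; rewrite ratr_norm.
Qed.

End ArchimedeanPlace.

(** * Maximal subrings are valuation rings *)

Section MaximalSubring.
Variables (F : fieldType) (S : subringClosed F) (pi : F).
Hypotheses (pi_neq0 : pi != 0) (piV : pi^-1 \notin S) (piS : pi \in S).
(** The form in which maximality of S among the subrings without 1/pi is used: adjoining x to S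
    produces 1/pi. *)
Hypothesis maxS :
  forall x, x \notin S -> exists2 f, f \is a polyOver S & f.[x] = pi^-1.

(** If the inverse of u = 1 - pi a were outside S, then 1/pi = f(1/u) with f over S. Multiplying by
    a power of u, which is again of the form 1 - pi b, gives 1/pi - b in S, a contradiction. *)
Lemma maximal_subring_unit a : a \in S -> (1 - pi * a)^-1 \in S.
Proof.
move=> aS; set u := 1 - pi * a.
have uS : u \in S by rewrite rpredB ?rpred1 ?rpredM.
have u0 : u != 0.
  apply: contra piV; rewrite subr_eq0 => /eqP pa1.
  by rewrite -[pi^-1]mulr1 pa1 mulKf.
apply: contraT => /maxS[f /polyOverP fS fu].
have [b bS ub] : exists2 b, b \in S & u ^+ size f = 1 - pi * b.
  elim: (size f) => [|k [b bS IHk]]; first by exists 0; rewrite ?rpred0 // mulr0 subr0.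
  exists (a + b - pi * (a * b)); first by rewrite rpredB ?rpredD ?rpredM.
  by rewrite exprS IHk /u; ring.
pose c := \sum_(i < size f) f`_i * u ^+ (size f - i).
have cS : c \in S by rewrite rpred_sum // => i _; rewrite rpredM ?rpredX.
have : u ^+ size f / pi = c.
  rewrite -fu horner_coef mulr_sumr; apply: eq_bigr => i _.
  by rewrite mulrCA exprVn -expfB.
rewrite ub mulrBl mul1r mulrAC divff // mul1r => /(canRL (subrK _)) e.
by move: piV; rewrite e rpredD.
Qed.

(** Chevalley's descent: if both x and 1/x are outside S, then f(x) = 1/pi = g(1/x) with f and g
    over S, and the longer of the two can always be shortened. The statement is symmetric under
    exchanging x and 1/x. *)
Lemma maximal_subring_valuation x : x \in S \/ x^-1 \in S.
Proof.
have [//|xS] := boolP (x \in S); first by left.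
have [//|xVS] := boolP (x^-1 \in S); first by right.
have x0 : x != 0 by apply: contraNneq xS => ->; rewrite rpred0.
have [f fS fx] := maxS xS; have [g gS gx] := maxS xVS.
elim: {f g}(_ + _)%N {-2}f {-2}g (leqnn (size f + size g)%N)
    fS gS x x0 {xS xVS} fx gx => [|N IHN] f g.
  rewrite leqn0 addn_eq0 => /andP[/eqP/size0nil f0 _] _ _ x _.
  move: f0; rewrite -[[::]]polyseq0 => /val_inj ->.
  by rewrite horner0 => /eqP; rewrite eq_sym invr_eq0 (negPf pi_neq0).
wlog gf : f g / (size g <= size f)%N => [th|].
  move=> fgN fS gS x x0 fx gx.
  have [gf|/ltnW fg] := leqP (size g) (size f); first exact: (th f g) fx gx.
  have := th g f fg; rewrite addnC => /(_ fgN gS fS x^-1).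
  by rewrite invr_eq0 invrK => /(_ x0 gx fx)[]; [right|left].
move=> fgN /polyOverP fS /polyOverP gS x x0 fx gx.
case sf: (size f) => [|n].
  move/eqP: sf; rewrite size_poly_eq0 => /eqP f0; move: fx.
  by rewrite f0 horner0 => /eqP; rewrite eq_sym invr_eq0 (negPf pi_neq0).
pose u := 1 - pi * g`_0; have uS : u^-1 \in S by apply: maximal_subring_unit.
have u0 : u != 0.
  apply: contra piV; rewrite subr_eq0 => /eqP pa1.
  by rewrite -[pi^-1]mulr1 pa1 mulKf.
(* Multiplied by x^n, the relation g(1/x) = 1/pi expresses x^n as pi / u times a polynomial in x of
   degree below n. Substituting this in the top term of f gives f'. *)
pose f' := \poly_(i < n) (f`_i + f`_n * pi / u * g`_(n - i)).
have gsum : \sum_(i < n) g`_(n - i) * x ^+ i = x ^+ n * u / pi.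
  rewrite -mulrA; have -> : u / pi = pi^-1 - g`_0 by rewrite /u; field.
  have gn : (size g <= n.+1)%N by rewrite -sf.
  move: gx; rewrite (horner_coef_wide _ gn) big_ord_recl expr0 mulr1.
  move=> <-; rewrite addrAC subrr add0r mulr_sumr.
  rewrite (reindex_inj rev_ord_inj); apply: eq_bigr => i _ /=.
  rewrite subKn // /bump leq0n add1n mulrCA; congr (_ * _).
  by rewrite exprVn expfB_cond // (negPf x0) add0n ltn_ord.
apply: (IHN f' g _ _ _ x x0) => //.
- by move: fgN; rewrite sf addSn ltnS; apply: leq_trans; rewrite leq_add2r size_poly.
- by apply: polyOver_poly => i _; rewrite rpredD // !rpredM.
- by apply/polyOverP.
rewrite horner_poly -fx (@horner_coef_wide _ n.+1 f) ?sf // big_ord_recr /=.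
under eq_bigr do rewrite mulrDl -[_ * _ * x ^+ _]mulrA.
rewrite big_split -mulr_sumr gsum /=; congr (_ + _); field.
by rewrite pi_neq0 u0.
Qed.

End MaximalSubring.

(** * The p-adic absolute values on [algC] *)

Section PadicPlace.
Variables (R : realType) (p : nat).
Hypothesis p_prime : prime p.

Let p0 : p%:R != 0 :> algC.
Proof. by rewrite pnatr_eq0 -lt0n prime_gt0. Qed.

Definition p_subring (A : set algC) : Prop :=
  [/\ A 1, forall x y, A x -> A y -> A (x - y),
      forall x y, A x -> A y -> A (x * y) & ~ A p%:R^-1].

Lemma p_subring_int : p_subring [set x | x \in Num.int].
Proof.
split=> [|x y|x y|] /=; [exact: rpred1|exact: rpredB|exact: rpredM|].
rewrite intrEge0 ?invr_ge0 ?ler0n // => /natrP[m /(congr1 ( *%R p%:R))].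
rewrite divff // -natrM => /eqP; rewrite eq_sym -[1]/(1%:R) eqr_nat.
by rewrite muln_eq1 => /andP[/eqP p1]; move: p_prime; rewrite p1.
Qed.

Lemma maximal_p_subring : exists A, p_subring A /\
  forall B, p_subring B -> A `<=` B -> B `<=` A.
Proof.
have [F FP Ftot|A [PA maxA]] :=
    @Zorn_bigcup _ [set A : set algC | A = set0 \/ p_subring A].
  have [[A0 FA0 PA0]|F0] := pselect (exists2 A, F A & p_subring A); last first.
    left; apply/seteqP; split=> // x [A FA Ax].
    case: (FP A FA) => [A0|PA]; first by rewrite A0 in Ax.
    by case: F0; exists A.
  have PF A x : F A -> A x -> p_subring A.
    by move=> /FP[->|].
  have common x y : (\bigcup_(X in F) X) x -> (\bigcup_(X in F) X) y ->
      exists A, [/\ F A, A x, A y & p_subring A].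
    move=> [A FA Ax] [B FB By]; have PA := PF _ _ FA Ax; have PB := PF _ _ FB By.
    by have [AB|BA] := Ftot A B FA FB; [exists B|exists A]; split; auto.
  right; split.
  - by exists A0 => //; case: PA0.
  - move=> x y xF yF; have [A [FA Ax Ay [_ AB _ _]]] := common x y xF yF.
    by exists A => //; apply: AB.
  - move=> x y xF yF; have [A [FA Ax Ay [_ _ AM _]]] := common x y xF yF.
    by exists A => //; apply: AM.
  - by move=> [A FA Ap]; have [_ _ _] := PF _ _ FA Ap; apply.
have {}PA : p_subring A.
  case: PA => // A0; case: (maxA [set x | x \in Num.int]); last first.
    by right; apply: p_subring_int.
  by rewrite A0; split=> // /(_ 0); apply; exact: rpred0.
exists A; split=> // B PB AB; apply: contrapT => nBA; apply: (maxA B); last by right.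
by split.
Qed.

(** For m prime to p, a Bezout relation writes a multiple of m as -(1 - p u) with u an integer,
    which is a unit by [maximal_subring_unit]. *)
Lemma p_valuation_ring : exists S : subringClosed algC,
  [/\ p%:R^-1 \notin S, forall x, x \in S \/ x^-1 \in S &
      forall m, coprime p m -> m%:R^-1 \in S].
Proof.
have [A [[A1 AB AM Ap] maxA]] := maximal_p_subring.
pose S0 : {pred algC} := [pred x | `[< A x >]].
have S0P x : reflect (A x) (x \in S0) by apply: asboolP.
have S0cl : subring_closed S0.
  split=> [|x y /S0P Ax /S0P Ay|x y /S0P Ax /S0P Ay]; apply/S0P => //.
  - exact: AB.
  - exact: AM.
pose S : subringClosed algC := HB.pack S0 (GRing.isSubringClosed.Build algC S0 S0cl).
have SP x : reflect (A x) (x \in S) by apply: asboolP.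
have pS : p%:R^-1 \notin S by apply/SP.
have maxS x : x \notin S -> exists2 f, f \is a polyOver S & f.[x] = p%:R^-1.
  move=> xS; apply: contrapT => nf.
  (* B is S[x]. If it missed 1/p, maximality would put B, and with it x, inside A. *)
  pose B := [set y | exists2 f, f \is a polyOver S & f.[x] = y].
  case/negP: xS; apply/SP; apply: (maxA B).
  - split=> [|_ _ [f fS <-] [h hS <-]|_ _ [f fS <-] [h hS <-]|].
    + by exists 1; rewrite ?rpred1 ?hornerC.
    + by exists (f - h); rewrite ?rpredB // !hornerE.
    + by exists (f * h); rewrite ?rpredM // !hornerE.
    + exact: nf.
  - by move=> y /SP yS; exists y%:P; rewrite ?polyOverC ?hornerC.
  - by exists 'X; rewrite ?polyOverX ?hornerX.
exists S; split=> // [x|m pm].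
  by apply: (maximal_subring_valuation p0 pS _ maxS); rewrite rpred_nat.
have [u /eqP hu] := coprimeP _ (prime_gt0 p_prime) pm.
have le : (u.2 * m <= u.1 * p)%N by rewrite ltnW // -subn_gt0 (eqP hu).
have e : m%:R * u.2%:R = - (1 - p%:R * u.1%:R) :> algC.
  rewrite -!natrM [(m * _)%N]mulnC [(p * _)%N]mulnC opprB -(subnK le) (eqP hu).
  by rewrite natrD addrAC subrr add0r.
have := maximal_subring_unit p0 pS _ maxS (rpred_nat S u.1).
rewrite rpred_nat => /(_ isT); set z := (1 - _) in e *; move=> zS.
have z0 : z != 0.
  apply: contra pS; rewrite subr_eq0 => /eqP pa1.
  have -> : p%:R^-1 = u.1%:R :> algC by apply: (mulfI p0); rewrite divff // -pa1.
  exact: rpred_nat.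
have m0 : m%:R != 0 :> algC.
  by apply: contraNneq z0 => m0; rewrite -oppr_eq0 -e m0 mul0r.
have -> : m%:R^-1 = - (u.2%:R * z^-1) :> algC.
  apply: (mulfI m0); rewrite divff // mulrN mulrA e mulNr opprK divff //.
by rewrite rpredN rpredM ?rpred_nat.
Qed.

Section Valuation.
Variable S : subringClosed algC.
Hypotheses (pVS : p%:R^-1 \notin S) (valS : forall x, x \in S \/ x^-1 \in S).
Hypothesis copS : forall m, coprime p m -> m%:R^-1 \in S.

Local Notation P := (p%:R : algC).

(* The test [x != 0] is needed because [0^-1 = 0]. *)
Definition vunit : {pred algC} := [pred x | [&& x != 0, x \in S & x^-1 \in S]].

Lemma vunitM x y : x \in vunit -> y \in vunit -> x * y \in vunit.
Proof.
move=> /and3P[x0 xS xVS] /and3P[y0 yS yVS].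
by rewrite inE mulf_neq0 // invfM !rpredM.
Qed.

Lemma vunitV x : x \in vunit -> x^-1 \in vunit.
Proof. by move=> /and3P[x0 xS xVS]; rewrite inE invr_eq0 invrK x0 xS xVS. Qed.

Lemma vunitX x n : x \in vunit -> x ^+ n \in vunit.
Proof.
move=> xu; elim: n => [|n IHn]; last by rewrite exprS vunitM.
by rewrite expr0 inE oner_eq0 invr1 rpred1.
Qed.

Lemma vunit_eq x y : x \in vunit -> x = y -> y \in vunit.
Proof. by move=> xu <-. Qed.

Lemma vunitN1 : -1 \in vunit.
Proof. by rewrite inE invrN1 rpredN1 oppr_eq0 oner_eq0. Qed.

Lemma vunit_p m n : P ^+ m / P ^+ n \in vunit -> m = n.
Proof.
wlog mn : m n / (n <= m)%N => [th|].
  have [/th//|/ltnW nm] := leqP n m => /vunitV; rewrite invf_div => /th.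
  by move=> /(_ nm).
rewrite -expfB_cond ?(negPf p0) //= -(subnK mn); move: (m - n)%N => [//|k].
rewrite addnK => /and3P[_ _ pk]; case/negP: pVS.
have -> : P^-1 = P ^+ k / P ^+ k.+1.
  by rewrite exprS invfM mulrC -mulrA mulVf ?mulr1 // expf_neq0.
by rewrite rpredM // rpredX // rpred_nat.
Qed.

(** A valuation ring is local: if x/y is in S and x + y is a unit, then 1/y = (x/y + 1) / (x + y) is
    in S. *)
Lemma nonunitD x y : x \in S -> y \in S -> x \notin vunit -> y \notin vunit ->
  x + y \notin vunit.
Proof.
move=> xS yS xu yu.
have [->|x0] := eqVneq x 0; first by rewrite add0r.
have [->|y0] := eqVneq y 0; first by rewrite addr0.
wlog xyS : x y xS yS xu yu x0 y0 / x / y \in S => [th|].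
  have [|yxS] := valS (x / y); first exact: th.
  by rewrite addrC th // -invf_div.
apply: contra yu => /and3P[xy0 _ xyVS]; rewrite inE y0 yS.
have -> : y^-1 = (x + y)^-1 * (x / y + 1) by field; rewrite xy0 y0.
by rewrite rpredM // rpredD ?rpred1.
Qed.

Lemma nonunit_sum (I : eqType) (r : seq I) (f : I -> algC) :
  (forall i, i \in r -> f i \in S /\ f i \notin vunit) ->
  \sum_(i <- r) f i \notin vunit.
Proof.
move=> hf; suff [] : \sum_(i <- r) f i \in S /\ \sum_(i <- r) f i \notin vunit by [].
rewrite big_seq; elim/big_rec: _ => [|i x /hf[fS fu] [xS xu]].
  by rewrite rpred0 inE eqxx.
by rewrite rpredD ?nonunitD.
Qed.

(** Divisibility by S is a total preorder, so a finite family has a term of least valuation. *)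
Lemma minimal_term (I : eqType) (r : seq I) (f : I -> algC) :
  r != [::] -> (forall i, i \in r -> f i != 0) ->
  exists2 i, i \in r & forall j, j \in r -> f j / f i \in S.
Proof.
elim: r => // i r IHr _ f0; have fi0 : f i != 0 by rewrite f0 ?mem_head.
have [->|/IHr[j jr|j jr hj]] := eqVneq r [::].
- by exists i; rewrite ?mem_head // => j; rewrite inE => /eqP ->; rewrite divff ?rpred1.
- by rewrite f0 // inE jr orbT.
have fj0 : f j != 0 by rewrite f0 // inE jr orbT.
have [ijS|jiS] := valS (f i / f j).
  exists j => [|k]; first by rewrite inE jr orbT.
  by rewrite inE => /predU1P[->|/hj].
rewrite invf_div in jiS; exists i => [|k]; first exact: mem_head.
rewrite inE => /predU1P[->|/hj kj]; first by rewrite divff ?rpred1.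
have -> : f k / f i = f k / f j * (f j / f i) by field; rewrite fi0.
by rewrite rpredM.
Qed.

Lemma vunit_nat m : (0 < m)%N -> m%:R / P ^+ logn p m \in vunit.
Proof.
move=> m0; have [m' pm' em] := pfactor_coprime p_prime m0.
have m'0 : m'%:R != 0 :> algC.
  by rewrite pnatr_eq0; apply: contraTneq m0 => e; rewrite em e.
rewrite {1}em natrM natrX mulfK ?expf_neq0 // inE m'0 rpred_nat.
exact: copS.
Qed.

Lemma vunit_ratr (q : rat) : q != 0 ->
  ratr q * P ^+ logn p `|denq q|%N / P ^+ logn p `|numq q|%N \in vunit.
Proof.
move=> q0; have n0 : (0 < `|numq q|)%N by rewrite absz_gt0 numq_eq0.
have d0 : (0 < `|denq q|)%N by rewrite absz_gt0 denq_eq0.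
have sgu : (-1) ^+ (numq q < 0)%R \in vunit by rewrite vunitX ?vunitN1.
apply: (vunit_eq (vunitM sgu (vunitM (vunit_nat n0) (vunitV (vunit_nat d0))))).
have numE : (numq q)%:~R = (-1) ^+ (numq q < 0)%R * `|numq q|%:R :> algC.
  by rewrite {1}[numq q]intEsign intrM rmorph_sign.
have denE : (denq q)%:~R = `|denq q|%:R :> algC by rewrite -{1}[denq q]absz_denq.
rewrite /ratr numE denE; field.
by rewrite !expf_neq0 // pnatr_eq0 -lt0n d0.
Qed.

(** The number t is the valuation of x normalized to be 1 at p: x^b is a unit times p^(c-a). Two
    natural exponents stand for one integer. *)
Definition pval_rep (x : algC) (t : R) : Prop := exists a c b : nat,
  [/\ (0 < b)%N, x ^+ b * P ^+ a / P ^+ c \in vunit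
    & t = (c%:R - a%:R) / b%:R].

(* Two terms of a vanishing rational linear combination of powers of x have   *)
(* the same valuation, so a power of x differs from a power of p by a unit.   *)
Lemma pval_rep_exists x : x != 0 -> exists t, pval_rep x t.
Proof.
move=> x0; have [f [fx fm] _] := minCpolyP x.
pose t (i : 'I_(size f)) := ratr f`_i * x ^+ i.
pose r := [seq i : 'I_(size f) <- enum 'I_(size f) | f`_i != 0].
have f0 : f != 0 by rewrite monic_neq0.
have inr i : (i \in r) = (f`_i != 0) by rewrite mem_filter mem_enum andbT.
have t0 i : i \in r -> t i != 0.
  by rewrite inr => fi; rewrite mulf_neq0 ?expf_neq0 // fmorph_eq0.
have szf : (0 < size f)%N by rewrite size_poly_gt0.
have rn0 : r != [::].
  have : Ordinal (etrans (ltn_predL (size f)) szf) \in r.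
    by rewrite inr /= -lead_coefE (monicP fm) oner_eq0.
  by move=> h; apply: contraTneq h => ->.
have [i ir hi] := minimal_term rn0 t0.
have sum0 : \sum_(j <- r) t j = 0.
  have /eqP := root_minCpoly x; rewrite fx horner_coef size_map_poly => e.
  rewrite -[RHS]e big_filter big_enum_cond [RHS](bigID (fun j : 'I_ _ => f`_j != 0)) /=.
  rewrite [X in _ = _ + X]big1 ?addr0; last first.
    by move=> j; rewrite negbK coef_map /= => /eqP ->; rewrite rmorph0 mul0r.
  by apply: eq_bigr => j _; rewrite coef_map.
have ur : uniq r by rewrite filter_uniq ?enum_uniq.
(* The quotients t_j / t_i with j other than i add up to -1, a unit, so they cannot all be
   non-units. *)
have [j [jr ji tu]] : exists j, [/\ j \in r, j != i & t j / t i \in vunit].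
  apply: contrapT => nj.
  have := @nonunit_sum _ [seq j <- r | j != i] (fun j => t j / t i).
  rewrite big_filter => /(_ _)/negP[].
    move=> j; rewrite mem_filter => /andP[ji jr]; split; first exact: hi.
    by apply/negP => tu; apply: nj; exists j.
  move: sum0; rewrite (bigD1_seq i) //= => /(canRL (addKr _)).
  rewrite -mulr_suml => ->; rewrite addr0 mulNr divff ?t0 //; exact: vunitN1.
have {tu} [a [c tu]] : exists a c, x ^+ j / x ^+ i * P ^+ a / P ^+ c \in vunit.
  rewrite !inr in ir jr; have [ui uj] := (vunit_ratr ir, vunit_ratr jr).
  have := vunitM tu (vunitM ui (vunitV uj)).
  set a1 := logn _ _ in uj *; set c1 := logn _ _ in uj *.
  set a2 := logn _ _ in ui *; set c2 := logn _ _ in ui * => U.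
  exists (a2 + c1)%N, (c2 + a1)%N; apply: (vunit_eq U).
  rewrite /t !exprD; field.
  by rewrite !expf_neq0 // !fmorph_eq0 ir jr.
have key m n a' c' : (m < n)%N ->
    x ^+ n / x ^+ m * P ^+ a' / P ^+ c' \in vunit -> exists t, pval_rep x t.
  move=> mn U; exists ((c'%:R - a'%:R) / (n - m)%:R), a', c', (n - m)%N.
  by rewrite subn_gt0 expfB_cond ?(negPf x0) //= ltnW.
have [ij|ij|ij] := ltngtP i j; first exact: key tu; last first.
  by case/eqP: ji; apply: val_inj.
apply: (key _ _ c a ij); apply: (vunit_eq (vunitV tu)).
by field; rewrite !expf_neq0.
Qed.

Lemma pval_rep_uniq x t t' : x != 0 -> pval_rep x t -> pval_rep x t' -> t = t'.
Proof.
move=> x0 [a [c [b [b0 U ->]]]] [a' [c' [b' [b'0 U' ->]]]].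
have := vunitM (vunitX b' U) (vunitV (vunitX b U')).
have -> : (x ^+ b * P ^+ a / P ^+ c) ^+ b' / (x ^+ b' * P ^+ a' / P ^+ c') ^+ b =
    P ^+ (a * b' + c' * b) / P ^+ (c * b' + a' * b).
  rewrite !exprMn !exprVn !exprD -!exprM [(b' * b)%N]mulnC; field.
  by rewrite !expf_neq0.
move=> /vunit_p /(congr1 (fun k => k%:R : R)); rewrite !natrD !natrM => e.
apply/eqP; rewrite eqr_div ?pnatr_eq0 -?lt0n //; apply/eqP.
by rewrite !mulrBl; lra.
Qed.

Lemma pval_repM x y t t' : x != 0 -> y != 0 ->
  pval_rep x t -> pval_rep y t' -> pval_rep (x * y) (t + t').
Proof.
move=> x0 y0 [a [c [b [b0 U ->]]]] [a' [c' [b' [b'0 U' ->]]]].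
exists (a * b' + a' * b)%N, (c * b' + c' * b)%N, (b * b')%N.
split; first by rewrite muln_gt0 b0.
  apply: (vunit_eq (vunitM (vunitX b' U) (vunitX b U'))).
  rewrite !exprMn !exprVn !exprD -!exprM [(b' * b)%N]mulnC; field.
  by rewrite !expf_neq0.
rewrite addf_div ?pnatr_eq0 -?lt0n // !natrD !natrM; congr (_ / _); ring.
Qed.

(** If x is outside S then 1/x is in S, and x is x^b times a power of 1/x. *)
Lemma valuation_ringX x b : (0 < b)%N -> (x ^+ b \in S) = (x \in S).
Proof.
case: b => // b _; apply/idP/idP => [xb|]; last exact: rpredX.
have [->|x0] := eqVneq x 0; first exact: rpred0.
have [//|xV] := valS x.
have -> : x = x ^+ b.+1 * x^-1 ^+ b by rewrite exprS exprVn mulfK ?expf_neq0.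
by rewrite rpredM // rpredX.
Qed.

Lemma pval_rep_ge0 x t : x != 0 -> pval_rep x t -> (0 <= t) = (x \in S).
Proof.
move=> x0 [a [c [b [b0 U ->]]]].
rewrite ler_pdivlMr ?ltr0n // mul0r subr_ge0 ler_nat -(valuation_ringX x b0).
have [ac|ca] := leqP a c.
  have -> : x ^+ b = (x ^+ b * P ^+ a / P ^+ c) * P ^+ (c - a).
    rewrite expfB_cond ?(negPf p0) //; field; rewrite !expf_neq0 //.
  by case/and3P: U => _ US _; rewrite rpredM // rpredX // rpred_nat.
apply/esym/negP => xbS; case/negP: pVS; case/and3P: U => _ _ UV.
have -> : P^-1 = (x ^+ b * P ^+ a / P ^+ c)^-1 * x ^+ b * P ^+ (a - c.+1).
  rewrite expfB_cond ?(negPf p0) //= exprS; field.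
  by rewrite !expf_neq0 ?p0.
by rewrite !rpredM // rpredX // rpred_nat.
Qed.

End Valuation.

Lemma padic_extension : exists w : algC -> R,
  [/\ absolute_value w, forall x y, w (x + y) <= Num.max (w x) (w y)
    & forall q, w (ratr q) = padic_abs R p q].
Proof.
have [S [pVS valS copS]] := p_valuation_ring.
have /choice[t ht] : forall x, exists t, x != 0 -> pval_rep S x t.
  move=> x; have [->|x0] := eqVneq x 0; first by exists 0.
  by have [t ht] : exists t, pval_rep S x t by [exact: pval_rep_exists]; exists t.
pose L : R := ln p%:R.
have lnp : 0 < L by rewrite ln_gt0 // ltr1n prime_gt1.
(* This is p^(-t), with t the normalized valuation, so S is the closed unit ball of w. *)
pose w x : R := if x == 0 then 0 else expR (- t x * L).
have w0 x : (w x == 0) = (x == 0).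
  by rewrite /w; case: (eqVneq x 0) => [_|_]; rewrite ?eqxx // gt_eqF ?expR_gt0.
have wM x y : w (x * y) = w x * w y.
  rewrite /w mulf_eq0; case: (eqVneq x 0) => [_|x0] /=; first by rewrite mul0r.
  case: (eqVneq y 0) => [_|y0] /=; first by rewrite mulr0.
  have xy0 : x * y != 0 by rewrite mulf_neq0.
  have -> : t (x * y) = t x + t y.
    exact: (pval_rep_uniq pVS xy0 (ht _ xy0) (pval_repM x0 y0 (ht _ x0) (ht _ y0))).
  by rewrite opprD mulrDl expRD.
have wS x : (w x <= 1) = (x \in S).
  rewrite /w; case: (eqVneq x 0) => [->|x0]; first by rewrite ler01 rpred0.
  rewrite -expR0 ler_expR mulNr oppr_le0 pmulr_lge0 //.
  exact: (pval_rep_ge0 pVS valS x0 (ht _ x0)).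
have wge0 x : 0 <= w x by rewrite /w; case: eqP => // _; rewrite expR_ge0.
have wmax x y : w (x + y) <= Num.max (w x) (w y).
  wlog xy : x y / w x <= w y => [th|].
    case/orP: (le_total (w x) (w y)) => [/th//|/th].
    by rewrite addrC maxC.
  rewrite le_max; apply/orP; right; have [y0|y0] := eqVneq y 0.
    move: xy; rewrite y0 addr0 (_ : w 0 = 0) //; last by apply/eqP; rewrite w0.
  have wy : 0 < w y by rewrite lt_def w0 y0 wge0.
  have -> : x + y = (x / y + 1) * y by field.
  rewrite wM -[leRHS]mul1r ler_pM2r // wS rpredD ?rpred1 // -wS.
  by rewrite -(ler_pM2r wy) -wM mul1r divfK.
have aw : absolute_value w.
  split=> // [x|x y]; first split=> [/eqP|->].
  - by rewrite w0 => /eqP.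
  - by apply/eqP; rewrite w0.
  by rewrite (le_trans (wmax x y)) // ge_max lerDl lerDr !wge0.
have wU x : x \in vunit S -> w x = 1.
  case/and3P => x0 xS xVS; apply/le_anti; rewrite wS xS /=.
  rewrite -invf_le1 ?lt_def ?w0 ?x0 ?wge0 // -(absvV aw) wS //.
have wp : w p%:R = p%:R^-1.
  have pn0 : p%:R != 0 :> algC by [].
  rewrite /w (negPf pn0) (_ : t p%:R = 1) ?mulN1r ?expRN /L ?lnK //.
    by rewrite posrE ltr0n prime_gt0.
  apply: (pval_rep_uniq pVS pn0 (ht _ pn0)); exists 0%N, 1%N, 1%N.
  by rewrite expr0 mulr1 expr1 divff // subr0 divr1 inE oner_eq0 invr1 rpred1.
exists w; split=> // q; rewrite /padic_abs; case: eqVneq => [->|q0].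
  by rewrite rmorph0 (absv0 aw).
have /wU := vunit_ratr copS q0.
rewrite (absvM aw (_ * _)) (absvM aw (ratr q)) (absvV aw) !(absvX aw) wp.
set A := w (ratr q); rewrite !exprVn => e.
have pn0 k : p%:R ^+ k != 0 :> R by rewrite expf_neq0 // pnatr_eq0 -lt0n prime_gt0.
move: e (pn0 (logn p `|denq q|)) (pn0 (logn p `|numq q|)).
move: (p%:R ^+ logn p `|denq q|) (p%:R ^+ logn p `|numq q|) => X Y e X0 Y0.
apply: (mulIf (_ : X^-1 / Y^-1 != 0)); first by rewrite !(mulf_neq0, invr_eq0).
by rewrite mulrA e; field; rewrite X0 Y0.
Qed.

End PadicPlace.

(** * Conjugates and embeddings *)

Definition alg_conjugates (x : algC) : seq algC :=
  projT1 (closed_field_poly_normal (minCpoly x)).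

Lemma minCpoly_conjugates x :
  minCpoly x = \prod_(z <- alg_conjugates x) ('X - z%:P).
Proof.
rewrite /alg_conjugates; case: closed_field_poly_normal => r /= {1}->.
by rewrite (monicP (minCpoly_monic x)) scale1r.
Qed.

Lemma mem_conjugates x z : (z \in alg_conjugates x) = root (minCpoly x) z.
Proof. by rewrite minCpoly_conjugates root_prod_XsubC. Qed.

Lemma conjugates_refl x : x \in alg_conjugates x.
Proof. by rewrite mem_conjugates root_minCpoly. Qed.

Lemma conjugates_root x z (q : {poly rat}) :
  z \in alg_conjugates x -> root (map_poly ratr q) x -> root (map_poly ratr q) z.
Proof.
rewrite mem_conjugates; have [f [-> _] ->] := minCpolyP x.
move=> fz /dvdpP[r ->]; rewrite rmorphM rootM fz orbT //.
Qed.

(** Let d be the gcd of f and f'. By minimality f divides f/d, which forces d constant, or it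
    divides d and hence f', which has smaller degree and is non-zero in characteristic 0. *)
Lemma conjugates_uniq x : uniq (alg_conjugates x).
Proof.
rewrite -separable_prod_XsubC -minCpoly_conjugates.
have [f [-> fm] fP] := minCpolyP x; rewrite separable_map unlock.
have f0 : f != 0 by rewrite monic_neq0.
have fx : root (map_poly ratr f) x by rewrite fP dvdpp.
have f1 : (1 < size f)%N.
  by rewrite -(size_map_poly (ratr : {rmorphism rat -> algC})) (root_size_gt1 _ fx) // map_poly_eq0.
have f'0 : f^`() != 0.
  apply/eqP => f'0; have : f^`()`_(size f).-2 = 0 by rewrite f'0 coef0.
  have sf : (0 < (size f).-1)%N by case: (size f) f1 => [|[]].
  rewrite coef_deriv prednK // -lead_coefE (monicP fm) => /eqP.
  by rewrite pnatr_eq0 eqn0Ngt sf.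
pose d := gcdp f f^`(); have df : d %| f by apply: dvdp_gcdl.
have d0 : d != 0 by rewrite gcdp_eq0 negb_and f0.
have : root (map_poly ratr (f %/ d * d)) x by rewrite divpK.
rewrite rmorphM rootM !fP => /orP[/dvdp_leq|fd].
  have fd0 : f %/ d != 0 by apply: contraNneq f0 => fd; rewrite -(divpK df) fd mul0r.
  move=> /(_ fd0); rewrite size_divp // => sf.
  have := size_poly_gt0 d; rewrite d0 /coprimep -/d eqn_leq => sd.
  rewrite sd andbT; case: (size d) sf sd => [|[|k]] //= sf _.
  by move: sf; rewrite leqNgt ltn_subrL (ltn_trans _ f1).
have /dvdp_leq := dvdp_trans fd (dvdp_gcdr f f^`()).
by move=> /(_ f'0); rewrite leqNgt lt_size_deriv.
Qed.

Section Embeddings.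
Variables (K : fieldExtType rat) (iota : {rmorphism K -> algC}) (g : K).
Hypothesis g_gen : <<1; g>>%VS = fullv.
Local Notation x := (iota g).

Lemma rmorph_horner_alg (P : {poly rat}) (f : {rmorphism K -> algC}) :
  f (map_poly (in_alg K) P).[g] = (map_poly ratr P).[f g].
Proof.
rewrite -horner_map -map_poly_comp; congr _.[_].
by apply: eq_map_poly => q /=; rewrite rmorphZ_num rmorph1 mulr1.
Qed.

Lemma generator_poly y : exists2 P : {poly rat},
  y = (map_poly (in_alg K) P).[g] & (size P <= size (alg_conjugates x))%N.
Proof.
have /polyOver1P[P eP] := Fadjoin_polyOver 1 g y.
have yP : y = (map_poly (in_alg K) P).[g].
  by rewrite -eP Fadjoin_poly_eq // g_gen memvf.
have [f [fx fm] fP] := minCpolyP x.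
have fg : (map_poly (in_alg K) f).[g] = 0.
  apply: (fmorph_inj iota); rewrite rmorph_horner_alg rmorph0; apply/rootP.
  by rewrite fP dvdpp.
exists (P %% f).
  by rewrite yP {1}(divp_eq P f) rmorphD rmorphM /= hornerD hornerM fg mulr0 add0r.
have := size_map_poly (ratr : {rmorphism rat -> algC}) f.
rewrite -fx minCpoly_conjugates size_prod_XsubC => sf.
by rewrite -ltnS sf ltn_modp monic_neq0.
Qed.

(** This makes the embedding that sends g to z well defined. *)
Lemma generator_poly_conj (P Q : {poly rat}) z : z \in alg_conjugates x ->
  (map_poly (in_alg K) P).[g] = (map_poly (in_alg K) Q).[g] ->
  (map_poly ratr P).[z] = (map_poly ratr Q).[z].
Proof.
move=> zx /(congr1 iota)/eqP; rewrite !rmorph_horner_alg -subr_eq0.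
rewrite -hornerN -hornerD -rmorphB => PQ; apply/eqP.
rewrite -subr_eq0 -hornerN -hornerD -rmorphB; exact: conjugates_root PQ.
Qed.

Lemma conjugate_embedding z : z \in alg_conjugates x ->
  exists f : {rmorphism K -> algC}, f g = z.
Proof.
move=> zx; have /choice[P hP] : forall y, exists P : {poly rat},
    y = (map_poly (in_alg K) P).[g].
  by move=> y; have [P yP _] := generator_poly y; exists P.
pose f y := (map_poly ratr (P y)).[z].
have fE y Q : y = (map_poly (in_alg K) Q).[g] -> f y = (map_poly ratr Q).[z].
  by move=> yQ; apply: generator_poly_conj => //; rewrite -hP.
have fB : zmod_morphism f.
  move=> y1 y2; rewrite (fE _ (P y1 - P y2)).
    by rewrite rmorphB hornerD hornerN.
  by rewrite rmorphB hornerD hornerN -!hP.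
have fM : monoid_morphism f.
  split; first by rewrite (fE _ 1) rmorph1 hornerC.
  move=> y1 y2; rewrite (fE _ (P y1 * P y2)) ?rmorphM /= ?hornerM //.
  by rewrite -!hP.
pose fa := GRing.isZmodMorphism.Build _ _ f fB.
pose fm := GRing.isMonoidMorphism.Build _ _ f fM.
pose F : {rmorphism K -> algC} := HB.pack f fa fm.
by exists F; rewrite /F /= (fE _ 'X) map_polyX hornerX.
Qed.

Lemma conjugate_embeddings :
  exists sg : 'I_(size (alg_conjugates x)) -> {rmorphism K -> algC},
    forall k, sg k g = (alg_conjugates x)`_k.
Proof.
have /choice[sg hsg] : forall k : 'I_(size (alg_conjugates x)),
    exists f : {rmorphism K -> algC}, f g = (alg_conjugates x)`_k.
  by move=> k; apply: conjugate_embedding; rewrite mem_nth.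
by exists sg.
Qed.

Lemma generator_span y :
  exists c : 'rV[rat]_(size (alg_conjugates x)), y = \sum_i c 0 i *: g ^+ i.
Proof.
have [P -> sP] := generator_poly y; exists (\row_i P`_i).
rewrite (horner_coef_wide _ (_ : (_ <= size (alg_conjugates x))%N)) ?size_map_poly //.
by apply: eq_bigr => i _; rewrite mxE coef_map /= mulr_algl.
Qed.

End Embeddings.

(** * A fixed extension to [algC] of each place of Q *)

Section PlaceExtension.
Variable R : realType.

Lemma rat_place_extension (p : rat_place) : exists w : algC -> R,
  [/\ absolute_value w, forall q, w (ratr q) = rat_place_abs R p q
    & p = RealPlace \/ forall x y, w (x + y) <= Num.max (w x) (w y)].
Proof.
case: p => [|p p_prime].
  exists (@real_abs R); split; [exact: real_abs_absolute_value| |by left].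
  exact: real_abs_rat.
by have [w [aw wmax wq]] := padic_extension R p_prime; exists w; split=> //; right.
Qed.

Definition place_ext (p : rat_place) : algC -> R :=
  sval (cid (rat_place_extension p)).

Lemma place_ext_abs p : absolute_value (place_ext p).
Proof. by rewrite /place_ext; case: cid => w []. Qed.

Lemma place_ext_rat p q : place_ext p (ratr q) = rat_place_abs R p q.
Proof. by rewrite /place_ext; case: cid => w []. Qed.

Lemma place_ext_ultra p (p_prime : prime p) x y :
  place_ext (PadicPlace p_prime) (x + y) <=
  Num.max (place_ext (PadicPlace p_prime) x) (place_ext (PadicPlace p_prime) y).
Proof. by rewrite /place_ext; case: cid => w [? ? [//|h]]; apply: h. Qed.

Lemma padic_abs_nat p m : (0 < m)%N -> padic_abs R p m%:R = p%:R ^- logn p m.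
Proof.
move=> m0; rewrite /padic_abs pnatr_eq0 eqn0Ngt m0 /= -[m%:R]/(m%:~R).
by rewrite numq_int denq_int /= logn1 expr0 invr1 divr1.
Qed.

Lemma place_ext_nontrivial p : exists q : rat, 1 < place_ext p (ratr q).
Proof.
case: p => [|p p_prime].
  by exists 2; rewrite place_ext_rat /= normr_nat ratr_nat ltr1n.
exists p%:R^-1; rewrite fmorphV (absvV (place_ext_abs _)) place_ext_rat /=.
rewrite padic_abs_nat ?prime_gt0 // logn_prime // eqxx expr1 invrK.
by rewrite ltr1n prime_gt1.
Qed.

End PlaceExtension.

(** * The Mahler measure as a product over conjugates *)

(* The places of Q are coded by 0 (the real place) and by the primes.         *)
Definition place_code (p : nat) : bool := (p == 0)%N || prime p.

(** Matching on the reflection proof supplies the primality argument of [PadicPlace]. Composite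
    numbers and 1 also fall on [RealPlace], hence the filter [place_code] in the products. *)
Definition place_of_code (p : nat) : rat_place :=
  if @idP (prime p) is ReflectT h then PadicPlace h else RealPlace.

Lemma place_of_code_prime p (h : prime p) : place_of_code p = PadicPlace h.
Proof.
rewrite /place_of_code; case: {-}_ / idP => // h'.
by congr PadicPlace; apply: bool_irrelevance.
Qed.

Lemma place_of_code0 : place_of_code 0 = RealPlace.
Proof. by rewrite /place_of_code; case: {-}_ / idP. Qed.

Lemma place_code_exists (p : rat_place) :
  exists2 c, place_code c & place_of_code c = p.
Proof.
case: p => [|p h]; first by exists 0%N; rewrite ?place_of_code0.
by exists p; rewrite ?place_of_code_prime // /place_code h orbT.
Qed.

Section PlaceOfNat.
Variable R : realType.
Local Notation w c := (place_ext R (place_of_code c)).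

(** The prime p is small at its own place only, so the restriction to Q determines the code. *)
Lemma place_abs_prime c p : place_code c -> prime p ->
  (w c (ratr p%:R) < 1) = (c == p).
Proof.
move=> cc p_prime; have [e|ep] := eqVneq c p.
  rewrite e (place_of_code_prime p_prime) place_ext_rat /=.
  rewrite padic_abs_nat ?prime_gt0 // logn_prime // eqxx expr1 invf_lt1 ?ltr0n ?prime_gt0 //.
  by rewrite ltr1n prime_gt1.
apply/negbTE; rewrite -leNgt; case/orP: cc => [/eqP -> | c_prime].
  by rewrite place_of_code0 place_ext_rat /= normr_nat ratr_nat ler1n prime_gt0.
rewrite (place_of_code_prime c_prime) place_ext_rat /= padic_abs_nat ?prime_gt0 //.
by rewrite logn_prime // (negPf ep) expr0 invr1.
Qed.

Lemma place_code_inj c c' : place_code c -> place_code c' ->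
  (forall q, w c (ratr q) = w c' (ratr q)) -> c = c'.
Proof.
move=> cc cc' e; case/orP: (cc) => [/eqP c0|pc].
  case/orP: (cc') => [/eqP -> //|pc'].
  have := place_abs_prime cc' pc'; rewrite eqxx -e => ec.
  by move: (place_abs_prime cc pc'); rewrite ec => /esym/eqP.
have := place_abs_prime cc pc; rewrite eqxx e => ec.
by move: (place_abs_prime cc' pc); rewrite ec => /esym/eqP.
Qed.

End PlaceOfNat.

Section Ultrametric.
Variables (R : realType) (w : algC -> R).
Hypothesis aw : absolute_value w.
Hypothesis ultra : forall x y, w (x + y) <= Num.max (w x) (w y).

Lemma ultra_sum I (r : seq I) (P : pred I) (f : I -> algC) (B : R) :
  0 <= B -> (forall i, P i -> w (f i) <= B) -> w (\sum_(i <- r | P i) f i) <= B.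
Proof.
move=> B0 fB; elim/big_rec: _ => [|i x /fB fi xB]; first by rewrite (absv0 aw).
by rewrite (le_trans (ultra _ _)) // ge_max fi.
Qed.

Lemma ultra_root_le1 (f : {poly algC}) z :
  f \is monic -> root f z -> (forall i, w f`_i <= 1) -> w z <= 1.
Proof.
move=> fm /rootP fz f1; rewrite leNgt; apply/negP => z1.
have f0 : f != 0 by rewrite monic_neq0.
have sf : size f = (size f).-1.+1 by rewrite prednK // size_poly_gt0.
move: fz; rewrite horner_coef sf big_ord_recr /=.
rewrite -lead_coefE (monicP fm) mul1r.
case: (size f).-1 => [|n].
  by rewrite big_ord0 add0r => /eqP; rewrite oner_eq0.
move=> /eqP; rewrite addr_eq0 => /eqP/(congr1 w); rewrite (absvN aw) (absvX aw).
move=> e; have : w z ^+ n.+1 <= w z ^+ n.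
  rewrite -e; apply: ultra_sum => [|i _]; first by rewrite exprn_ge0 ?absv_ge0.
  rewrite (absvM aw) (absvX aw) -[leRHS]mul1r ler_pM ?exprn_ge0 ?absv_ge0 //.
  by rewrite ler_weXn2l ?ltW // -ltnS.
by rewrite leNgt ltr_eXn2l ?ltnSn.
Qed.

End Ultrametric.

Definition local_mahler (R : realType) (w : algC -> R) (x : algC) : R :=
  \prod_(z <- alg_conjugates x) Num.max 1 (w z).

(** Raising the height to the power [K : Q] clears the denominator of the exponent in [place_abs]
    and leaves the local degree. *)
Lemma max1_powR (R : realType) (a : R) (m N : nat) : 0 <= a -> (0 < N)%N ->
  Num.max 1 (a `^ (m%:R / N%:R)) ^+ N = Num.max 1 a ^+ m.
Proof.
move=> a0 N0; have r0 : 0 <= m%:R / N%:R :> R by rewrite divr_ge0.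
have -> : Num.max 1 (a `^ (m%:R / N%:R)) = Num.max 1 a `^ (m%:R / N%:R).
  have [a1|/ltW a1] := leP a 1.
    rewrite powR1; apply/max_l.
    by rewrite -[leRHS](congr1 (@^~ (m%:R / N%:R)) (powR1 R)) ge0_ler_powR ?nnegrE.
  apply/max_r.
  by rewrite -[leLHS](congr1 (@^~ (m%:R / N%:R)) (powR1 R)) ge0_ler_powR ?nnegrE.
have M0 : 0 <= Num.max 1 a by rewrite le_max ler01.
rewrite -powR_mulrn ?powR_ge0 // -powRrM divfK ?powR_mulrn //.
by rewrite pnatr_eq0 -lt0n.
Qed.

(** A prime at least B exceeds every denominator of the minimal polynomial, whose roots are then
    integral at p. *)
Lemma denominator_bound (R : realType) (x : algC) : exists B : nat,
  forall p (h : prime p) z, (B <= p)%N -> z \in alg_conjugates x ->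
    place_ext R (PadicPlace h) z <= 1.
Proof.
have [f [fx fm] _] := minCpolyP x.
exists (\sum_(i < size f) `|denq f`_i|.+1)%N => p h z Bp.
rewrite mem_conjugates => fz.
apply: (ultra_root_le1 (place_ext_abs R _) (@place_ext_ultra R p h) (minCpoly_monic x) fz).
move=> i; rewrite fx coef_map /= place_ext_rat /= /padic_abs.
case: (eqVneq f`_i 0) => [_|fi0]; first exact: ler01.
have si : (i < size f)%N.
  by rewrite ltnNge; apply: contraNN fi0 => /(nth_default 0) ->.
rewrite [X in _ / p%:R ^- X]ltn_log0; last first.
  by apply: leq_trans Bp; rewrite (bigD1 (Ordinal si)) //= leq_addr.
rewrite expr0 invr1 divr1 invf_le1 ?exprn_gt0 ?ltr0n ?prime_gt0 //.
by rewrite exprn_ege1 // ler1n prime_gt0.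
Qed.

(** Valid for every large n, so that several numbers can be compared over one finite list of
    places. *)
Lemma mahlerE (R : realType) (x : algC) : exists B : nat, forall n, (B <= n)%N ->
  mahler R x =
  \prod_(p <- iota 0 n | place_code p) local_mahler (place_ext R (place_of_code p)) x.
Proof.
(* The successor makes n positive, so that the real place, of code 0, is in the list. *)
have [B0 hB0] := denominator_bound R x; exists B0.+1 => n Bn.
pose K := Qfield x; pose iota_ := Qfield_inj x; pose g := Qfield_gen x.
have gx : iota_ g = x by exact: Qfield_inj_gen.
have ggen : <<1; g>>%VS = fullv by exact: Qfield_genE.
have [sg hsg] := conjugate_embeddings iota_ ggen.
have gsp := generator_span iota_ ggen.
have sginj : injective (fun k => sg k g).
  move=> i j; rewrite !hsg => /eqP; rewrite nth_uniq ?conjugates_uniq //.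
  by move=> /eqP/val_inj.
move: sg hsg gsp sginj; rewrite gx => sg hsg gsp sginj.
pose w c := place_ext R (place_of_code c).
have aw c : absolute_value (w c) by apply: place_ext_abs.
pose s := [seq c <- iota 0 n | place_code c].
pose I := enum 'I_(size (alg_conjugates x)).
(* A list with repetitions: each place occurs in it as often as its local degree, so a plain product
   over [LL] is the weighted product over the distinct places. *)
pose LL : seq (K -> R) := [seq w c \o sg k | c <- s, k <- I].
have sgq c k q : (w c \o sg k) q%:A = w c (ratr q).
  by rewrite /= rmorphZ_num rmorph1 mulr1.
have vLL v c : absolute_value v -> place_code c -> (forall q, v q%:A = w c (ratr q)) ->
    exists k, v = w c \o sg k.
  move=> av cc vw; have [k <-] := place_is_embedding sginj gsp (aw c) av vw
    (place_ext_nontrivial R _).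
  by exists k.
have LLP v : v \in LL -> exists c k, [/\ place_code c, (c < n)%N & v = w c \o sg k].
  move=> /allpairsP[[c k] /= [cs kI ->]]; exists c, k; split=> //.
    by move: cs; rewrite mem_filter => /andP[].
  by move: cs; rewrite mem_filter mem_iota => /and3P[].
have LLplaces v : v \in LL -> places R K v.
  move=> /LLP[c [k [cc cn ->]]]; split; first exact: absolute_value_comp.
  by exists (place_of_code c) => q; rewrite sgq /w place_ext_rat.
have count_LL v : v \in LL -> count_mem v LL = local_degree v.
  move=> vL; have [c [k [cc cn ve]]] := LLP v vL.
  have av : absolute_value v by have [] := LLplaces v vL.
  have vw q : v q%:A = w c (ratr q) by rewrite ve sgq.
  rewrite (local_degree_embeddings sginj gsp (aw c) av vw (place_ext_nontrivial R _)).
  have cs : c \in s by rewrite mem_filter cc mem_iota.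
  have us : uniq s by rewrite filter_uniq ?iota_uniq.
  (* Different codes differ already on Q, so only the block of c contributes to the count. *)
  rewrite count_flatten -map_comp sumnE big_map (bigD1_seq c) //=.
  rewrite [X in (_ + X)%N]big1_seq ?addn0; last first.
    move=> c' /andP[c'c]; rewrite mem_filter => /andP[cc' _].
    apply/eqP; rewrite -leqn0 leqNgt -has_count; apply/hasPn => v'.
    move=> /mapP[k' _ ->] /=; apply: contra c'c => /eqP e; apply/eqP.
    apply: (@place_code_inj R) => // q; rewrite -/(w c) -/(w c') -vw -e.
    by rewrite sgq.
  rewrite count_map -sum1_count /I big_enum_cond -sum1_card; apply: eq_bigl => k'.
  by rewrite /= inE; apply/eqP/asboolP.
pose h (v : K -> R) := Num.max 1 (place_abs v g).
have N0 : (0 < global_degree K)%N by rewrite /global_degree adim_gt0.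
(* A place outside the list lies over a prime beyond the denominator bound, where g has absolute
   value at most 1. *)
have h1 v : places R K v -> v \notin undup LL -> h v = 1.
  move=> [av [p vp]]; rewrite mem_undup => vLn.
  have [c cc ec] := place_code_exists p.
  have vw q : v q%:A = w c (ratr q) by rewrite vp /w ec place_ext_rat.
  have [k ve] := vLL v c av cc vw.
  have cn : (n <= c)%N.
    rewrite leqNgt; apply: contra vLn => cn; rewrite ve.
    apply/allpairsP; exists (c, k); split=> //=; last by rewrite mem_enum.
    by rewrite mem_filter cc mem_iota.
  have pc : prime c.
    by case/orP: cc => // /eqP c0; move: (leq_trans Bn cn); rewrite c0.
  have vg1 : v g <= 1.
    rewrite ve /= hsg /w (place_of_code_prime pc); apply: hB0; last by rewrite mem_nth.
    by rewrite (leq_trans _ cn) // ltnW.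
  have hN : h v ^+ global_degree K = 1.
    by rewrite max1_powR ?absv_ge0 // (max_l vg1) expr1n.
  apply/eqP; rewrite -(pexpr_eq1 N0) ?hN //.
  by rewrite le_max ler01.
rewrite /mahler /weil_height /field_height -/K -/g.
rewrite (@fsbigE _ _ _ _ (places R K) (undup LL) h) ?undup_uniq //; last first.
  by move=> v /=; rewrite mem_undup; apply: LLplaces.
rewrite big_seq_cond.
rewrite (eq_bigl (fun v => v \in undup LL)); last first.
  move=> v /=; rewrite mem_undup andb_idr // => vL; apply/mem_set; exact: LLplaces.
rewrite -big_seq -prodrXl.
rewrite (eq_big_seq (fun v => iterop (count_mem v LL) *%R (Num.max 1 (v g)) 1)); last first.
  move=> v; rewrite mem_undup => vL; rewrite count_LL //.
  have [av _] := LLplaces v vL.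
  by rewrite -/(h v) max1_powR ?absv_ge0.
rewrite big_undup_iterop_count big_allpairs_dep big_filter; apply: eq_bigr => c cc.
rewrite /local_mahler (big_nth 0) big_mkord /I big_enum; apply: eq_bigr => k _ /=.
by rewrite hsg.
Qed.

(** * Bounds on the Mahler measure *)

Lemma big_fiber (R : comNzRingType) (S T : eqType) (r : seq S) (t : seq T)
    (phi : S -> T) (F : S -> R) :
  uniq t -> (forall z, z \in r -> phi z \in t) ->
  \prod_(z <- r) F z = \prod_(b <- t) \prod_(z <- r | phi z == b) F z.
Proof.
move=> ut rt; under [RHS]eq_bigr do rewrite big_mkcond.
rewrite exchange_big big_seq [RHS]big_seq; apply: eq_bigr => z /rt zt /=.
rewrite (bigD1_seq (phi z)) //= eqxx big1 ?mulr1 // => b.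
by rewrite eq_sym => /negPf ->.
Qed.

Section LocalMahler.
Variables (R : realType) (w : algC -> R).
Hypothesis aw : absolute_value w.
Local Notation F z := (Num.max 1 (w z)).

Lemma max1_ge1 (a : R) : 1 <= Num.max 1 a. Proof. by rewrite le_max lexx. Qed.

Lemma max1_ge0 (a : R) : 0 <= Num.max 1 a. Proof. by rewrite le_max ler01. Qed.

Lemma prod_max1_ge1 I (r : seq I) (P : pred I) (f : I -> R) :
  1 <= \prod_(i <- r | P i) Num.max 1 (f i).
Proof.
elim/big_rec: _ => // i x _ x1.
by rewrite -[leLHS]mulr1 ler_pM ?ler01 ?max1_ge1.
Qed.

Lemma local_mahler_ge1 x : 1 <= local_mahler w x.
Proof. exact: prod_max1_ge1. Qed.

Lemma max1X (a : R) d : 0 <= a -> (0 < d)%N -> Num.max 1 a ^+ d = Num.max 1 (a ^+ d).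
Proof.
move=> a0 d0; have [a1|/ltW a1] := leP a 1.
  by rewrite expr1n max_l // exprn_ile1.
by rewrite max_r // exprn_ege1.
Qed.

Lemma max1_prod_le I (r : seq I) (P : pred I) (f : I -> algC) :
  F (\prod_(i <- r | P i) f i) <= \prod_(i <- r | P i) F (f i).
Proof.
rewrite ge_max prod_max1_ge1 (absv_prod aw); apply: ler_prod => i _.
by rewrite absv_ge0 // le_max lexx orbT.
Qed.

(** The d-th power maps the conjugates of x to those of b. A fibre over b' has at most d elements,
    all with the same value w, so its factors multiply to at most the factor of b'. *)
Lemma local_mahler_root x b d : (0 < d)%N -> x ^+ d = b ->
  local_mahler w x <= local_mahler w b.
Proof.
move=> d0 xb.
have cxb z : z \in alg_conjugates x -> z ^+ d \in alg_conjugates b.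
  move=> zx; rewrite mem_conjugates; have [f [fb fm] fP] := minCpolyP b.
  have := @conjugates_root x z (f \Po 'X^d) zx.
  rewrite map_comp_poly map_polyXn !rootE !horner_comp !hornerXn -fb xb.
  by apply; rewrite -rootE root_minCpoly.
rewrite /local_mahler (big_fiber _ (conjugates_uniq b) cxb); apply: ler_prod.
move=> b' _; rewrite prodr_ge0 => [|z _]; last exact: max1_ge0.
rewrite -big_filter /=; set t := (X in \prod_(z <- X) _).
have tP z : z \in t -> z ^+ d = b' by rewrite mem_filter => /andP[/eqP].
have st : (size t <= d)%N.
  rewrite -ltnS -(size_XnsubC b' d0); apply: max_poly_roots.
  - by rewrite -size_poly_gt0 size_XnsubC.
  - by apply/allP => z /tP zb; rewrite rootE !hornerE zb subrr.
  - by rewrite filter_uniq ?conjugates_uniq.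
case: t tP st => [|z0 t] tP st; first by rewrite big_nil max1_ge1.
have wz z : z \in z0 :: t -> w z = w z0.
  move=> zt; apply/eqP; rewrite -(@eqrXn2 _ d) ?absv_ge0 // -!(absvX aw).
  by rewrite !tP ?mem_head.
rewrite (eq_big_seq (fun=> F z0)); last by move=> z /wz ->.
rewrite big_const_seq count_predT iter_mulr_1 -(tP z0 (mem_head _ _)) (absvX aw).
by rewrite -max1X ?absv_ge0 // ler_weXn2l ?max1_ge1.
Qed.

Lemma local_mahler_unity_root x d : (0 < d)%N -> x ^+ d = 1 -> local_mahler w x = 1.
Proof.
move=> d0 xd; rewrite /local_mahler big_seq big1 // => z zx.
have zd : z ^+ d = 1.
  have := @conjugates_root x z ('X^d - 1) zx.
  have -> : map_poly ratr ('X^d - 1) = 'X^d - 1 :> {poly algC}.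
    by rewrite rmorphB /= map_polyXn rmorph1.
  rewrite !rootE !hornerE xd subrr eqxx.
  by move=> /(_ isT); rewrite subr_eq0 => /eqP.
suff -> : w z = 1 by rewrite maxxx.
by apply/eqP; rewrite -(pexpr_eq1 d0) ?absv_ge0 // -(absvX aw) zd (absv1 aw).
Qed.

(** Multiplying a polynomial by X - z enlarges its coefficients by at most 1 + w z, which is at most
    twice the factor of z. *)
Lemma coef_conjugates_le x i :
  w (minCpoly x)`_i <= 2 ^+ size (alg_conjugates x) * local_mahler w x.
Proof.
rewrite minCpoly_conjugates /local_mahler; elim: (alg_conjugates x) i => [|z r IHr] i.
  rewrite !big_nil mulr1 coef1; case: eqP => _ /=; rewrite ?(absv1 aw) //.
  by rewrite (absv0 aw) ler01.
rewrite !big_cons mulrBl coefB coefXM coefCM /=.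
set M := \prod_(j <- r) Num.max 1 _; set p := \prod_(j <- r) ('X - _) in IHr *.
have M0 : 0 <= M by apply: prodr_ge0 => j _; apply: max1_ge0.
rewrite (le_trans (absvB_le aw _ _)) //.
pose k := 2 ^+ size r * M; have k0 : 0 <= k by rewrite mulr_ge0 ?exprn_ge0.
have -> : 2 ^+ (size r).+1 * (F z * M) = 2 * (F z * k) by rewrite /k exprS; ring.
apply: (@le_trans _ _ (k + F z * k)); last first.
  have : 0 <= (F z - 1) * k by rewrite mulr_ge0 // subr_ge0 max1_ge1.
  by rewrite mulrBl mul1r; lra.
apply: lerD.
  by case: eqP => // _; rewrite (absv0 aw) mulr_ge0 ?exprn_ge0.
by rewrite (absvM aw) ler_pM ?absv_ge0 // le_max lexx orbT.
Qed.

(** The ultrametric inequality removes the factor 2 per root, so no constant accumulates when the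
    bounds at all primes are multiplied. *)
Lemma ultra_coef_conjugates_le x i :
  (forall x y, w (x + y) <= Num.max (w x) (w y)) ->
  w (minCpoly x)`_i <= local_mahler w x.
Proof.
move=> ultra; rewrite minCpoly_conjugates /local_mahler.
elim: (alg_conjugates x) i => [|z r IHr] i.
  by rewrite !big_nil coef1; case: eqP => _ /=; rewrite ?(absv1 aw) ?(absv0 aw) ?ler01.
rewrite !big_cons mulrBl coefB coefXM coefCM /=.
set M := \prod_(j <- r) Num.max 1 _; set p := \prod_(j <- r) ('X - _) in IHr *.
have M0 : 0 <= M by apply: prodr_ge0 => j _; apply: max1_ge0.
rewrite (le_trans (ultra _ _)) // ge_max (absvN aw); apply/andP; split.
  case: eqP => _; first by rewrite (absv0 aw) mulr_ge0 ?max1_ge0.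
  by rewrite (le_trans (IHr _)) // ler_peMl ?max1_ge1.
by rewrite (absvM aw) ler_pM ?absv_ge0 // le_max lexx orbT.
Qed.

End LocalMahler.

(** * Coefficient bounds and Northcott's theorem *)

Section MahlerBounds.
Variable R : realType.
Local Notation w c := (place_ext R (place_of_code c)).

Lemma mahler_le x y :
  (forall w : algC -> R, absolute_value w -> local_mahler w x <= local_mahler w y) ->
  mahler R x <= mahler R y.
Proof.
move=> xy; have [B1 h1] := mahlerE R x; have [B2 h2] := mahlerE R y.
rewrite (h1 (maxn B1 B2)) ?leq_maxl // (h2 (maxn B1 B2)) ?leq_maxr //.
apply: ler_prod => p _; rewrite (le_trans ler01 (local_mahler_ge1 _ _)) /=.
exact: xy (place_ext_abs _ _).
Qed.

Lemma mahler_unity_root x d : (0 < d)%N -> x ^+ d = 1 -> mahler R x = 1.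
Proof.
move=> d0 xd; have [B /(_ B (leqnn B)) ->] := mahlerE R x.
by rewrite big1 // => p _; apply: local_mahler_unity_root xd => //; apply: place_ext_abs.
Qed.

Lemma mahler_ge1 x : 1 <= mahler R x.
Proof.
have [B /(_ B (leqnn B)) ->] := mahlerE R x.
elim/big_rec: _ => // p y _ y1; rewrite -[leLHS]mulr1 ler_pM ?ler01 //.
exact: local_mahler_ge1.
Qed.

Lemma local_mahler_le_mahler p x : place_code p -> local_mahler (w p) x <= mahler R x.
Proof.
move=> pc; have [B hB] := mahlerE R x.
rewrite (hB (maxn B p.+1)) ?leq_maxl // -big_filter (bigD1_seq p) /=.
- rewrite ler_peMr ?(le_trans ler01 (local_mahler_ge1 _ _)) //.
  elim/big_rec: _ => // q y _ y1; rewrite -[leLHS]mulr1 ler_pM ?ler01 //.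
  exact: local_mahler_ge1.
- by rewrite mem_filter pc mem_iota /= leq_max ltnSn orbT.
- by rewrite filter_uniq ?iota_uniq.
Qed.

(** The numerator being prime to the denominator, the part of the denominator at a prime p dividing
    it is the p-adic absolute value of the coefficient, hence at most the local measure at p. *)
Lemma denq_le_mahler x (f : {poly rat}) i : minCpoly x = map_poly ratr f ->
  `|denq f`_i|%:R <= mahler R x.
Proof.
move=> fx; set q := f`_i; have [B hB] := mahlerE R x.
set d := `|denq q|%N; have d0 : (0 < d)%N by rewrite absz_gt0 denq_eq0.
(* Being at least d, n bounds every prime factor of d. *)
set n := maxn B d.
rewrite (hB n.+1); last by rewrite (leq_trans (leq_maxl B d)).
have -> : d = (\prod_(p <- iota 0 n.+1 | place_code p) p ^ logn p d)%N.
  rewrite -{1}(partnT d0) (widen_partn _ (leq_maxr B d)) big_mkcond [RHS]big_mkcond.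
  rewrite /index_iota subn0 /=; apply: eq_bigr => p _; case: ifP => // /norP[_ np].
  by rewrite lognE (negPf np).
rewrite natr_prod; apply: ler_prod => p pc; rewrite ler0n /=.
have [p0|pp] := orP pc.
  by rewrite (eqP p0) lognE expn0 local_mahler_ge1.
have [dp|] := posnP (logn p d); first by rewrite dp expn0 local_mahler_ge1.
rewrite logn_gt0 mem_primes => /and3P[_ _ pd].
have np : logn p `|numq q| = 0%N.
  apply: logn_coprime; apply: coprime_dvdl pd _.
  by rewrite coprime_sym coprime_num_den.
have := @ultra_coef_conjugates_le _ _ (place_ext_abs R (place_of_code p)) x i.
rewrite (place_of_code_prime pp) => /(_ (@place_ext_ultra R _ pp)); apply: le_trans.
rewrite fx coef_map place_ext_rat /= /padic_abs -/q -/d np expr0 invr1 mul1r invrK.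
case: eqP => [q0|_]; last by rewrite natrX.
by move: pd; rewrite /d q0 -[0]/(0%:~R) denq_int dvdn1 => /eqP p1; rewrite p1 in pp.
Qed.

(** The numerator is the coefficient, bounded at the real place, times its denominator; each
    contributes one factor M(x). *)
Lemma numq_le_mahler x (f : {poly rat}) i : minCpoly x = map_poly ratr f ->
  `|numq f`_i|%:R <= 2 ^+ size (alg_conjugates x) * mahler R x ^+ 2.
Proof.
move=> fx; set q := f`_i.
have wq : ratr `|q| <= 2 ^+ size (alg_conjugates x) * mahler R x.
  have := coef_conjugates_le (place_ext_abs R (place_of_code 0)) x i.
  rewrite fx coef_map place_of_code0 place_ext_rat /= -/q => /le_trans; apply.
  rewrite ler_pM2l ?exprn_gt0 // -place_of_code0.
  exact: local_mahler_le_mahler.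
have -> : `|numq q|%:R = ratr `|q| * `|denq q|%:R :> R.
  have d0 : (denq q)%:~R != 0 :> rat by rewrite intr_eq0 denq_eq0.
  have e : `|numq q|%:R = `|q| * `|denq q|%:R :> rat.
    rewrite !natr_absz !intr_norm -normrM -{2}(divq_num_den q).
    by rewrite divfK.
  by rewrite -[LHS](ratr_nat R) e rmorphM /= ratr_nat.
rewrite expr2 mulrA ler_pM ?ler0q ?ler0n //; exact: denq_le_mahler fx.
Qed.

Lemma mahler_minCpoly x y : minCpoly x = minCpoly y -> mahler R x = mahler R y.
Proof.
move=> e; have c : alg_conjugates x = alg_conjugates y by rewrite /alg_conjugates e.
by apply/le_anti/andP; split; apply: mahler_le => v _; rewrite /local_mahler c.
Qed.

Lemma northcott (D : nat) (B : R) : finite_set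
  [set mahler R x | x in [set x | (size (alg_conjugates x) <= D)%N /\ mahler R x <= B]].
Proof.
(* A strict bound for numerators and denominators alike; [|B| + 1] is at least 1, so its square also
   dominates the bound for denominators. *)
pose N := (Num.bound (2 ^+ D * (`|B| + 1) ^+ 2)).+1.
pose T := {ffun 'I_D.+1 -> bool * 'I_N * 'I_N}.
pose P (t : T) : {poly rat} := \poly_(i < D.+1)
  (let: (b, a, d) := t (inord i) in (-1) ^+ b * (a : nat)%:R / (d : nat)%:R).
(* Any number with minimal polynomial [P t] will do, since the measure depends only on that
   polynomial. *)
pose m (t : T) : R := mahler R (xget 0 [set x | minCpoly x = map_poly ratr (P t)]).
apply: (@sub_finite_set _ _ (range m)); last by apply: finite_image; apply: finite_finset.
move=> _ [x [xD xB] <-]; have [f [fx fm] _] := minCpolyP x.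
have B1 : mahler R x <= `|B| + 1.
  by rewrite (le_trans xB) // (le_trans (ler_norm B)) // lerDl.
have hN k : k%:R <= 2 ^+ D * (`|B| + 1) ^+ 2 -> (k < N)%N.
  move=> kB; rewrite ltnS -(ler_nat R) (le_trans kB) // ltW // archi_boundP //.
have nN i : (`|numq f`_i| < N)%N.
  apply: hN; apply: le_trans (numq_le_mahler i fx) _.
  have M0 : 0 <= mahler R x := le_trans ler01 (mahler_ge1 x).
  apply: ler_pM.
  - by rewrite exprn_ge0.
  - by apply: exprn_ge0.
  - by rewrite ler_weXn2l // ler1n.
  - by apply: lerXn2r => //; rewrite nnegrE addr_ge0.
have dN i : (`|denq f`_i| < N)%N.
  apply: hN; apply: le_trans (denq_le_mahler i fx) _; apply: le_trans B1 _.
  rewrite -[leLHS]mul1r ler_pM ?addr_ge0 //; first by rewrite exprn_ege1 ?ler1n.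
  by rewrite expr2 ler_peMl ?addr_ge0 // lerDr.
pose t : T := [ffun i : 'I_D.+1 =>
  ((numq f`_i < 0)%R, Ordinal (nN i), Ordinal (dN i))].
have Pt : P t = f.
  apply/polyP => i; rewrite coef_poly; case: ltnP => [iD|Di].
    rewrite ffunE inordK //= -[RHS]divq_num_den; congr (_ / _).
      by rewrite {3}[numq f`_i]intEsign intrM rmorph_sign.
    by rewrite -{2}[denq f`_i]absz_denq.
  rewrite nth_default // (leq_trans _ Di) //.
  have := size_map_poly (ratr : {rmorphism rat -> algC}) f.
  by rewrite -fx minCpoly_conjugates size_prod_XsubC => <-.
exists t => //; apply: mahler_minCpoly; rewrite fx -Pt.
by case: xgetP => [y _ -> //|/(_ x)]; rewrite /= Pt fx.
Qed.

End MahlerBounds.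

(** * Galois orbits *)

Lemma prod_subset_le (R : realType) (T : eqType) (s t : seq T) (F : T -> R) :
  uniq s -> uniq t -> {subset s <= t} -> (forall z, 1 <= F z) ->
  \prod_(z <- s) F z <= \prod_(z <- t) F z.
Proof.
move=> us ut st F1; have F0 z : 0 <= F z by apply: le_trans (F1 z).
rewrite [leRHS](bigID (mem s)) /= -[X in _ <= X * _]big_filter.
have st_perm : perm_eq s [seq z <- t | z \in s].
  apply: uniq_perm => //; first by rewrite filter_uniq.
  by move=> z; rewrite mem_filter andb_idr // => /st.
rewrite (perm_big _ st_perm) ler_peMr ?prodr_ge0 //; elim/big_rec: _ => // z x _ x1.
by rewrite -[leLHS]mulr1 ler_pM ?ler01.
Qed.

Lemma rmorph_conjugates (L : fieldExtType rat) (iota f : {rmorphism L -> algC}) a :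
  f a \in alg_conjugates (iota a).
Proof.
rewrite mem_conjugates; have [q [qa qm] qP] := minCpolyP (iota a).
rewrite qa /root -rmorph_horner_alg fmorph_eq0 -(fmorph_eq0 iota).
by rewrite rmorph_horner_alg -qa -rootE root_minCpoly.
Qed.

Section GaloisConjugates.
Variables (L : splittingFieldType rat) (iota : {rmorphism L -> algC}).

Lemma galois_conjugates (E : {subfield L}) a z :
  galois 1 E -> a \in E -> z \in alg_conjugates (iota a) ->
  exists2 g : gal_of E, g \in 'Gal(E / 1)%g & z = iota (g a).
Proof.
move=> /(galois_factors (sub1v E)) galE /galE[r [rG _ eqr]] za.
have /polyOver1P[q eq_q] := minPolyOver 1 a.
have qa : root (map_poly ratr q) (iota a).
  by rewrite /root -rmorph_horner_alg -eq_q (rootP (root_minPoly 1 a)) rmorph0.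
have := conjugates_root za qa.
have -> : map_poly ratr q = map_poly iota (minPoly 1 a).
  rewrite eq_q -map_poly_comp; apply: eq_map_poly => c /=.
  by rewrite rmorphZ_num rmorph1 mulr1.
rewrite eqr rmorph_prod.
under eq_bigr do rewrite rmorphB /= map_polyX map_polyC.
rewrite -(big_map iota predT (fun b => 'X - b%:P)) root_prod_XsubC -map_comp.
by move=> /mapP[g gr ->]; exists g => //; apply: (fintype.subsetP rG).
Qed.

Definition galois_orbit (A : {set gal_of {:L}}) (y : L) : seq L :=
  undup [seq (g : gal_of {:L}) y | g <- enum A].

Lemma galois_orbitP (A : {set gal_of {:L}}) y z :
  reflect (exists2 g : gal_of {:L}, g \in A & z = g y) (z \in galois_orbit A y).
Proof.
rewrite mem_undup; apply: (iffP mapP) => [[g gA ->]|[g gA ->]]; exists g => //.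
  by rewrite mem_enum in gA.
by rewrite mem_enum.
Qed.

Lemma galois_orbit_uniq A y : uniq (galois_orbit A y).
Proof. exact: undup_uniq. Qed.

Lemma galMf (g h : gal_of {:L}) y : (g * h)%g y = h (g y).
Proof. by rewrite galM ?memvf. Qed.

Lemma prod_galois_orbit_eq (A : {set gal_of {:L}}) y (s : seq L) :
  uniq s -> s =i galois_orbit A y ->
  \prod_(r <- s) r = \prod_(r <- galois_orbit A y) r.
Proof. by move=> us e; apply/perm_big/uniq_perm => //; apply: galois_orbit_uniq. Qed.

Section Norm.
Variable H : {group gal_of {:L}}.

(** Each orbit element is taken once, whatever the stabilizer: this product over distinct conjugates
    of y is what the measure of y controls. *)
Definition orbit_norm (y : L) : L := \prod_(r <- galois_orbit H y) r.

Lemma orbit_norm_fixed h y : h \in H -> orbit_norm (h y) = orbit_norm y.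
Proof.
move=> hH; apply: prod_galois_orbit_eq; first exact: galois_orbit_uniq.
move=> z; apply/galois_orbitP/galois_orbitP => -[k kH ->].
  by exists (h * k)%g; rewrite ?groupM // galMf.
by exists (h^-1 * k)%g; rewrite ?groupM ?groupV // -galMf mulKVg.
Qed.

Lemma orbit_norm_gal (g : gal_of {:L}) y : g \in 'N(H)%g ->
  g (orbit_norm y) = orbit_norm (g y).
Proof.
move=> gN; rewrite /orbit_norm rmorph_prod /= -(big_map g predT id).
apply: prod_galois_orbit_eq.
  by rewrite map_inj_uniq ?galois_orbit_uniq //; apply: fmorph_inj.
move=> z; apply/mapP/galois_orbitP => [[_ /galois_orbitP[k kH ->] ->]|[k kH ->]].
  exists (k ^ g)%g; first by rewrite memJ_norm.
  by rewrite -!galMf conjgE mulKVg.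
exists ((k ^ g^-1)%g y).
  by apply/galois_orbitP; exists (k ^ g^-1)%g; rewrite ?memJ_norm ?groupV.
by rewrite -!galMf conjgE invgK mulgA mulgKV.
Qed.

(** The exponent m is the order of the stabilizer of y: the elements of H with a given value at y
    form a right coset of it. *)
Lemma orbit_norm_power y : exists2 m : nat,
  #|H| = (size (galois_orbit H y) * m)%N &
  \prod_(h in H) h y = orbit_norm y ^+ m.
Proof.
pose s := [seq (g : gal_of {:L}) y | g <- enum H].
pose m := #|[set h in H | (h : gal_of {:L}) y == y]|.
have cnt r : r \in undup s -> count_mem r s = m.
  move=> /galois_orbitP[k kH ->]; rewrite count_map -sum1_count big_enum_cond.
  rewrite /m -(card_rcoset _ k) -sum1_card; apply: eq_bigl => h.
  rewrite mem_rcoset !inE /= groupMr ?groupV // galMf.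
  congr (_ && _); apply/eqP/eqP => e; first by rewrite e -galMf mulgV gal_id.
  by rewrite -{2}e -galMf mulVg gal_id.
exists m.
- have : \sum_(r <- undup s) 1%:R *+ count_mem r s = \sum_(r <- s) 1%:R :> rat.
    exact: big_undup_iterop_count.
  rewrite (eq_big_seq (fun=> m%:R)); last by move=> r /cnt ->.
  rewrite !big_const_seq !count_predT !iter_addr_0 -mulrnA => /eqP.
  by rewrite eqr_nat mulnC size_map -cardE => /eqP <-.
- rewrite -big_enum -(big_map (fun h : gal_of {:L} => h y) predT id) /=.
  rewrite -[LHS](big_undup_iterop_count _ s predT id).
  rewrite (eq_big_seq (fun r => r ^+ m)); last by move=> r /cnt ->.
  by rewrite prodrXl.
Qed.

End Norm.

Hypothesis galL : galois 1 {:L}.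

Lemma conjugates_orbit y :
  perm_eq (alg_conjugates (iota y)) [seq iota r | r <- galois_orbit 'Gal({:L} / 1)%g y].
Proof.
apply: uniq_perm; first exact: conjugates_uniq.
  by rewrite map_inj_uniq ?galois_orbit_uniq //; apply: fmorph_inj.
move=> z; apply/idP/mapP => [zy|[_ /galois_orbitP[g gG ->] ->]].
  have [g gG ->] := galois_conjugates galL (memvf y) zy.
  by exists (g y) => //; apply/galois_orbitP; exists g.
exact: (rmorph_conjugates iota (iota \o (g : 'AEnd(L)))).
Qed.

Lemma size_conjugates_le y : (size (alg_conjugates (iota y)) <= #|'Gal({:L} / 1)%g|)%N.
Proof.
rewrite (perm_size (conjugates_orbit y)) size_map cardE.
by rewrite (leq_trans (size_undup _)) // size_map.
Qed.

Lemma local_mahler_orbit (R : realType) (w : algC -> R) y :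
  local_mahler w (iota y) =
  \prod_(r <- galois_orbit 'Gal({:L} / 1)%g y) Num.max 1 (w (iota r)).
Proof. by rewrite /local_mahler (perm_big _ (conjugates_orbit y)) big_map. Qed.

(* The conjugates of N(y) are the norms of the conjugates of y, and each is   *)
(* a product over an H-orbit contained in its fibre under the norm.           *)
Lemma local_mahler_orbit_norm (R : realType) (w : algC -> R)
    (H : {group gal_of {:L}}) y :
  absolute_value w -> normal H 'Gal({:L} / 1)%g ->
  local_mahler w (iota (orbit_norm H y)) <= local_mahler w (iota y).
Proof.
move=> aw /andP[HG GN]; rewrite !local_mahler_orbit.
have phi z : z \in galois_orbit 'Gal({:L} / 1)%g y ->
    orbit_norm H z \in galois_orbit 'Gal({:L} / 1)%g (orbit_norm H y).
  move=> /galois_orbitP[g gG ->]; apply/galois_orbitP; exists g => //.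
  by rewrite orbit_norm_gal // (fintype.subsetP GN).
rewrite [leRHS](big_fiber _ (galois_orbit_uniq _ _) phi).
rewrite [leLHS]big_seq [leRHS]big_seq; apply: ler_prod => b /galois_orbitP[g gG ->].
rewrite max1_ge0 /= orbit_norm_gal ?(fintype.subsetP GN) //.
have -> : iota (orbit_norm H (g y)) = \prod_(r <- galois_orbit H (g y)) iota r.
  by rewrite rmorph_prod.
rewrite -[leRHS]big_filter; apply: le_trans (max1_prod_le aw _ _ _) _.
apply: (prod_subset_le (F := fun r => Num.max 1 (w (iota r)))).
- exact: galois_orbit_uniq.
- by rewrite filter_uniq ?galois_orbit_uniq.
- move=> _ /galois_orbitP[h hH ->]; rewrite mem_filter orbit_norm_fixed // eqxx /=.
  apply/galois_orbitP; exists (g * h)%g; last by rewrite galMf.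
  by rewrite groupM // (fintype.subsetP HG).
- by move=> z; apply: max1_ge1.
Qed.

End GaloisConjugates.

(** The field generated by all conjugates of the given numbers is a splitting field of the product
    of their minimal polynomials. *)
Lemma normal_num_field (s : seq algC) :
  exists (L : splittingFieldType rat) (iota : {rmorphism L -> algC}),
    galois 1 {:L} /\
    forall x z, x \in s -> z \in alg_conjugates x -> exists y, iota y = z.
Proof.
have [Qs [QsC [s1 es1 gens1]]] := num_field_exists (flatten [seq alg_conjugates x | x <- s]).
have /choice[f hf] : forall x, exists f : {poly rat}, minCpoly x = map_poly ratr f.
  by move=> x; have [f [fx _] _] := minCpolyP x; exists f.
pose p : {poly Qs} := \prod_(x <- s) map_poly (in_alg Qs) (f x).
have axQ : SplittingField.axiom Qs.
  exists p.
    by apply: rpred_prod => x _; apply/polyOver1P; exists (f x).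
  exists s1 => //; suff -> : p = \prod_(z <- s1) ('X - z%:P) by apply: eqpxx.
  apply: (map_poly_inj QsC); rewrite !rmorph_prod /=.
  under [RHS]eq_bigr do rewrite rmorphB /= map_polyX map_polyC.
  rewrite -(big_map QsC predT (fun b => 'X - b%:P)) es1 big_flatten big_map.
  apply: eq_bigr => x _; rewrite -minCpoly_conjugates hf -map_poly_comp.
  by apply: eq_map_poly => c /=; rewrite rmorphZ_num rmorph1 mulr1.
pose L : splittingFieldType rat :=
  HB.pack (FieldExt.sort Qs) (FieldExt_isSplittingField.Build _ Qs axQ).
exists L, QsC; split.
  have sep : separable 1 {:L}.
    by apply/separableP => y _; apply: pcharf0_separable => q; rewrite pchar_lalg pchar_num.
  rewrite /galois sub1v sep /=; apply/splitting_normalField; first exact: sub1v.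
  exact: axQ.
move=> x z xs zx; have : z \in [seq QsC i | i <- s1].
  by rewrite es1; apply/flattenP; exists (alg_conjugates x) => //; apply: map_f.
by move=> /mapP[y _ ->]; exists y.
Qed.

(** * Attaining the infimum *)

Lemma adjoin_seq_in_image (L L' : fieldExtType rat) (iota : {rmorphism L -> algC})
    (iota' : {rmorphism L' -> algC}) (E : {subfield L'}) (rs : seq L) :
  (forall x, x \in rs -> (iota' @` [set` E]) (iota x)) ->
  forall y, y \in <<1 & rs>>%VS -> (iota' @` [set` E]) (iota y).
Proof.
pose S := iota' @` [set` E].
have SD a b : S a -> S b -> S (a + b).
  by move=> [x xE <-] [z zE <-]; exists (x + z); rewrite ?rmorphD //=; apply: rpredD.
have SM a b : S a -> S b -> S (a * b).
  by move=> [x xE <-] [z zE <-]; exists (x * z); rewrite ?rmorphM //=; apply: rpredM.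
have SQ (q : rat) : S (ratr q).
  exists q%:A; last by rewrite rmorphZ_num rmorph1 mulr1.
  by rewrite /= rpredZ // mem1v.
elim/last_ind: rs => [|rs x IHrs] Srs y.
  rewrite adjoin_nil (subfield_closed 1%AS) => /vlineP[q ->].
  by rewrite rmorphZ_num rmorph1 mulr1; apply: SQ.
have Sx : S (iota x) by apply: Srs; rewrite mem_rcons mem_head.
have {}IHrs : forall y, y \in <<1 & rs>>%VS -> S (iota y).
  by apply: IHrs => z zrs; apply: Srs; rewrite mem_rcons inE zrs orbT.
rewrite adjoin_rcons => yx.
have := Fadjoin_poly_eq yx; set p := Fadjoin_poly _ _ _ => <-.
have /polyOverP pK : p \is a polyOver <<1 & rs>>%AS by apply: Fadjoin_polyOver.
rewrite horner_coef rmorph_sum; apply: (big_ind S) => [|//|i _].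
  by rewrite -(rmorph0 (ratr : {rmorphism rat -> algC})); apply: SQ.
rewrite rmorphM rmorphXn; apply: (SM); first exact: IHrs.
elim: (val i) => [|k IHk]; last by rewrite exprS; apply: SM.
by rewrite expr0 -(rmorph1 (ratr : {rmorphism rat -> algC})); apply: SQ.
Qed.

(** The Galois fields in the definition of [galois_closure] are unrelated to L, so the comparison
    goes through images in [algC]: a Galois field containing [alpha] contains all its conjugates,
    hence what they generate. *)
Lemma adjoin_conjugates_galois_closure (L : fieldExtType rat)
    (iota : {rmorphism L -> algC}) (rs : seq L) (alpha : algC) y :
  (forall x, x \in rs -> iota x \in alg_conjugates alpha) ->
  y \in <<1 & rs>>%VS -> galois_closure alpha (iota y).
Proof.
move=> rsa yrs L' iota' E galE [a aE ea].
apply: adjoin_seq_in_image yrs => x /rsa; rewrite -ea => xa.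
have [g gG ->] := galois_conjugates galE aE xa.
by exists (g a) => //=; apply: memv_gal.
Qed.

Lemma mahler_radical_factor (R : realType) (alpha : algC) (N : nat)
    (a : 'I_N -> algC) :
  alpha != 0 -> alpha = \prod_(i < N) a i ->
  exists (b c : 'I_N -> algC) (zeta : algC),
    [/\ alpha = zeta * \prod_(i < N) c i,
        exists2 n, (0 < n)%N & zeta ^+ n = 1,
        forall i, galois_closure alpha (b i),
        forall i, exists2 d, (0 < d)%N & c i ^+ d = b i
      & forall i, mahler R (b i) <= mahler R (a i)].
Proof.
move=> alpha0 alphaE.
have [L [iota [galL preim]]] := normal_num_field (alpha :: codom a).
have preim_conj z : z \in alg_conjugates alpha -> exists y, iota y = z.
  by apply: preim; rewrite mem_head.
have [A eA] : exists y, iota y = alpha by apply: preim_conj; apply: conjugates_refl.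
have /choice[gam hgam] : forall i, exists y, iota y = a i.
  move=> i; apply: (preim (a i)); last exact: conjugates_refl.
  by rewrite inE codom_f orbT.
have /choice[pre hpre] : forall z, exists y, z \in alg_conjugates alpha -> iota y = z.
  move=> z; have [/preim_conj[y yz]|nz] := boolP (z \in alg_conjugates alpha).
    by exists y.
  by exists 0.
pose rs := [seq pre z | z <- alg_conjugates alpha].
have rsE : [seq iota y | y <- rs] = alg_conjugates alpha.
  by rewrite -map_comp -[RHS]map_id; apply/eq_in_map => z zc; apply: hpre.
pose K0 : {subfield L} := <<1 & rs>>%AS.
have [f [fa fm] _] := minCpolyP alpha.
have normK0 : normalField 1 K0.
  apply/splitting_normalField; first exact: sub1v.
  exists (map_poly (in_alg L) f); first by apply/polyOver1P; exists f.
  exists rs => //; suff -> : map_poly (in_alg L) f = \prod_(z <- rs) ('X - z%:P).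
    exact: eqpxx.
  apply: (map_poly_inj iota); rewrite rmorph_prod /=.
  under [RHS]eq_bigr do rewrite rmorphB /= map_polyX map_polyC.
  rewrite -(big_map iota predT (fun b => 'X - b%:P)) rsE -minCpoly_conjugates fa.
  rewrite -map_poly_comp; apply: eq_map_poly => c /=.
  by rewrite rmorphZ_num rmorph1 mulr1.
pose H := 'Gal({:L} / K0)%G.
have HG : normal H 'Gal({:L} / 1)%g.
  by apply: normalField_normal normK0; rewrite sub1v subvf.
have galK0 : galois K0 {:L} by apply: galoisS galL; rewrite sub1v subvf.
have fixH : fixedField H = K0 by apply/galois_fixedField.
have normK y : orbit_norm H y \in K0.
  rewrite -fixH; apply/fixedFieldP; first exact: memvf.
  move=> h hH; rewrite orbit_norm_gal ?orbit_norm_fixed //.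
  by apply: (fintype.subsetP (normG H)).
pose d i := size (galois_orbit H (gam i)).
have d0 i : (0 < d i)%N.
  rewrite lt0n size_eq0; apply/eqP => e.
  have : gam i \in galois_orbit H (gam i).
    by apply/galois_orbitP; exists 1%g; rewrite ?group1 ?gal_id.
  by rewrite e.
pose b i := iota (orbit_norm H (gam i)).
pose c i := (d i).-root (b i).
have cb i : c i ^+ d i = b i by rewrite /c rootCK.
have H0 : (0 < #|H|)%N by rewrite cardG_gt0.
have AK0 : A \in K0.
  apply: seqv_sub_adjoin; rewrite -(mem_map (fmorph_inj iota)) rsE eA.
  exact: conjugates_refl.
have gamA : \prod_(i < N) gam i = A.
  apply: (fmorph_inj iota); rewrite rmorph_prod eA alphaE.
  by apply: eq_bigr => i _; apply: hgam.
(* The |H|-th power of c_i is the relative norm of the i-th factor. These norms multiply to the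
   relative norm of [alpha], which H fixes. *)
have cH : (\prod_(i < N) c i) ^+ #|H| = alpha ^+ #|H|.
  rewrite -prodrXl (eq_bigr (fun i => iota (\prod_(h in H) h (gam i)))).
    rewrite -rmorph_prod exchange_big /= -eA -rmorphXn -prodr_const; congr (iota _).
    apply: eq_bigr => h hH; rewrite -rmorph_prod gamA.
    by move: AK0; rewrite -fixH => /mem_fixedFieldP[_]; apply.
  move=> i _; have [m -> ->] := orbit_norm_power H (gam i).
  by rewrite exprM cb rmorphXn.
have c0 : \prod_(i < N) c i != 0.
  by have := expf_neq0 #|H| alpha0; rewrite -cH expf_eq0 H0.
exists b, c, (alpha / \prod_(i < N) c i); split.
- by rewrite divfK.
- by exists #|H| => //; rewrite expr_div_n cH divff // expf_neq0.
- move=> i; apply: (@adjoin_conjugates_galois_closure _ iota rs) (normK (gam i)).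
  by move=> x xrs; rewrite -rsE; apply: map_f.
- by move=> i; exists (d i).
- move=> i; apply: mahler_le => w aw; rewrite -hgam.
  exact: local_mahler_orbit_norm.
Qed.

(** This converts measures close to the infimum m into measures at most m. *)
Lemma finite_set_gap (R : realType) (A : set R) (m : R) : finite_set A ->
  exists2 e, 0 < e & forall x, A x -> x < m + e -> x <= m.
Proof.
move=> /finite_seqP[s ->]; elim: s => [|x s [e e0 he]]; first by exists 1.
have [xm|mx] := leP x m.
  exists e => // z /=; rewrite inE => /predU1P[-> //|zs]; exact: he.
exists (Num.min e (x - m)); first by rewrite lt_min e0 subr_gt0.
move=> z /=; rewrite inE => /predU1P[->|zs].
  by rewrite -ltrBlDl lt_min ltxx andbF.
by rewrite -ltrBlDl lt_min => /andP[ze _]; apply: he => //; rewrite -ltrBlDl.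
Qed.

Lemma max_mahler_le (R : realType) (N : nat) (a : 'I_N.+1 -> algC) (B : R) :
  max_mahler R a <= B <-> forall i, mahler R (a i) <= B.
Proof.
split=> [/bigmax_leP[_ aB] i|aB]; first exact: aB.
by apply/bigmax_leP.
Qed.

Theorem theorem1p2 (R : realType) (alpha : algC) (halpha : alpha != 0) :
  (exists (N : nat) (a : 'I_N.+1 -> algC),
     [/\ forall i, radicals (galois_closure alpha) (a i),
         alpha = \prod_(i < N.+1) a i
       & mahler_infty R alpha = max_mahler R a]) /\
  mahler_infty_set R alpha (mahler_infty R alpha).
Proof.
pose m := mahler_infty R alpha.
have lb1 : lbound (mahler_infty_set R alpha) 1.
  move=> _ [N [a [_ _ ->]]]; apply: le_trans (mahler_ge1 R (a ord0)) _.
  by have [+ _] := max_mahler_le a (max_mahler R a); apply.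
have ne : mahler_infty_set R alpha !=set0.
  exists (max_mahler R (fun _ : 'I_1 => alpha)), 0%N, (fun=> alpha).
  by split=> //; rewrite big_ord1.
have hinf : has_inf (mahler_infty_set R alpha) by split=> //; exists 1.
have m1 : 1 <= m by apply: lb_le_inf.
have [L [iota [galL preim]]] := normal_num_field [:: alpha].
have [A eA] : exists y, iota y = alpha.
  by apply: (preim alpha); rewrite ?mem_head ?conjugates_refl.
have deg x : galois_closure alpha x ->
    (size (alg_conjugates x) <= #|'Gal({:L} / 1)%g|)%N.
  move=> /(_ L iota {:L}%AS galL)[].
    by exists A => //=; apply: memvf.
  by move=> y _ <-; apply: size_conjugates_le.
have [e e0 gap] := finite_set_gap m
  (northcott #|'Gal({:L} / 1)%g| (m + 1)).
(* The bound 1 keeps the measures of the b_i in the range m + 1 of the finite set; the bound e then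
   forces them down to m. *)
have e10 : 0 < Num.min e 1 by rewrite lt_min e0 ltr01.
have [_ [N [a [a0 aE ->]]] am] := inf_adherent e10 hinf.
have {}am i : mahler R (a i) < m + Num.min e 1.
  by apply: le_lt_trans am; have [+ _] := max_mahler_le a (max_mahler R a); apply.
have [b [c [zeta [alphaE [n n0 zn] bK cb ba]]]] := mahler_radical_factor R halpha aE.
have bm i : mahler R (b i) <= m.
  have := le_lt_trans (ba i) (am i); rewrite -ltrBlDl lt_min => /andP[be b1].
  apply: gap; last by rewrite -ltrBlDl.
  by exists (b i) => //; split; [exact: deg|rewrite -lerBlDl ltW].
(* The root of unity is the extra factor, at index 0; its measure 1 is at most m because every
   measure is at least 1. *)
pose a' (i : 'I_N.+2) := if unlift ord0 i is Some j then c j else zeta.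
have a'E : alpha = \prod_(i < N.+2) a' i.
  rewrite big_ord_recl {1}/a' unlift_none alphaE; congr (_ * _).
  by apply: eq_bigr => i _; rewrite /a' liftK.
have a'0 i : a' i != 0.
  by move: halpha; rewrite a'E => /prodf_neq0; apply.
have galX x d : x != 0 -> (0 < d)%N -> galois_closure alpha (x ^+ d) ->
    radicals (galois_closure alpha) x.
  by move=> x0 d0 xd; split=> //; exists d.
have gal1 : galois_closure alpha 1.
  by move=> L' iota' E _ _; exists 1; rewrite ?rmorph1 //=; apply: mem1v.
have a'rad i : radicals (galois_closure alpha) (a' i).
  have := a'0 i; rewrite /a'; case: unliftP => [j _|_] x0.
    by have [d d0 e'] := cb j; apply: (galX _ d) => //; rewrite e'.
  by apply: (galX _ n) => //; rewrite zn.
have a'm : m = max_mahler R a'.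
  apply/le_anti/andP; split.
    apply: ge_inf; first by exists 1.
    by exists N.+1, a'.
  apply/max_mahler_le => i; rewrite /a'; case: unliftP => [j _|_].
    apply: le_trans (bm j); have [d d0 e'] := cb j.
    by apply: mahler_le => w aw; apply: local_mahler_root e'.
  by rewrite (mahler_unity_root R n0 zn).
split; first by exists N.+1, a'.
by exists N.+1, a'.
Qed.
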